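(* For every convex polyhedron $P\subset\mathbb R^3$, the antipodal square complex $X(P)$ satisfies \[ H_i(X(P);\mathbb Z)\cong \begin{cases} \mathbb Z, & i=0,\\ \mathbb Z/2, & i=1,\\ \mathbb Z^{\delta(P)}, & i=2,\\ 0, & i\ge 3. \end{cases} \]
   Context: A convex polyhedron $P\subset\mathbb R^3$ means a compact full-dimensional convex polytope. Two points of $P$ are antipodal if there are two parallel supporting planes of $P$, one through each point, that contain $P$ between them. $V(P)$ is the number of vertices of $P$; $A(P)$ is the number of unordered pairs of distinct vertices of $P$ that are antipodal; $B(P)$ is the number of unordered pairs of distinct edges of $P$ whose midpoints are antipodal. The antipodal defect is $\delta(P)=V(P)-1-A(P)+B(P)$. The antipodal graph $G_A(P)$ has as vertices the vertices of $P$, with an edge $vw$ whenever $v,w$ are distinct antipodal vertices. The antipodal square complex $X(P)$ is the two-dimensional finite CW complex obtained from $G_A(P)$ by attaching one square 2-cell for every unordered pair $\{e,f\}$ of distinct edges of $P$ whose midpoints are antipodal: if $e=vv'$ and $f=ww'$, the square is attached along the four-cycle $v-w-v'-w'-v$ (such $e,f$ are disjoint, so the four vertices are distinct, and the four vertex pairs used are antipodal). Different edge pairs giving the same boundary cycle still give distinct 2-cells. *)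

(* Defs.v *)
From HB Require Import structures.
From mathcomp Require Import all_boot all_order all_algebra.
From mathcomp Require Import finmap.
From mathcomp Require Import ring lra.
From mathcomp Require Import all_classical all_reals all_analysis.

Set Implicit Arguments.
Unset Strict Implicit.
Unset Printing Implicit Defensive.

Import Order.TTheory GRing.Theory Num.Theory.
Import numFieldNormedType.Exports.

Local Open Scope classical_set_scope.
Local Open Scope ring_scope.

(** Unordered pairs of distinct elements of [T] related by the symmetric
    relation [r]; the pair {x, y} is represented by whichever of (x, y) and
    (y, x) is increasing for the enumeration of [T]. *)
Definition upair (T : finType) (r : rel T) : finType :=
  {p : T * T | (enum_rank p.1 < enum_rank p.2)%N && r p.1 p.2}.

(** A finite simple graph [sq_adj] on [sq_vertex] with square 2-cells, each
    attached along a four-cycle of the graph; several squares may have the same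
    boundary. *)
Record square_complex := SquareComplex {
  sq_vertex : finType;
  sq_adj : rel sq_vertex;
  sq_face : finType;
  sq_attach : sq_face -> 4.-tuple sq_vertex;
  sq_adj_sym : symmetric sq_adj;
  sq_adj_irr : irreflexive sq_adj;
  sq_attach_cycle : forall q, ucycleb sq_adj (sq_attach q)
}.

Section CellularHomology.
Variable X : square_complex.

Definition cell (i : nat) : finType :=
  match i with
  | 0 => sq_vertex X
  | 1 => upair (@sq_adj X)
  | 2 => sq_face X
  | _ => void
  end.

(** Multiplicity, in the edge path going from [a] to [b], of the 1-cell [e]
    oriented from its first to its second vertex. *)
Definition path_step (a b : sq_vertex X) (e : cell 1) : int :=
  (val e == (a, b))%:Z - (val e == (b, a))%:Z.

(** Degree of the attaching map of the first cell over the second one. *)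
Definition incidence (i : nat) : cell i.+1 -> cell i -> int :=
  match i with
  | 0 => fun e v => (v == (val e).2)%:Z - (v == (val e).1)%:Z
  | 1 => fun q e => \sum_(k < 4)
           path_step (tnth (sq_attach q) k) (tnth (sq_attach q) (ordS k)) e
  | _ => fun _ _ => 0
  end.

Definition chain (i : nat) : zmodType := {ffun cell i -> int}.

Definition boundary (i : nat) (c : chain i.+1) : chain i :=
  [ffun y => \sum_x c x * incidence x y].

Definition is_cycle (i : nat) : {pred chain i} :=
  match i with
  | 0 => fun _ => true
  | j.+1 => fun z : chain j.+1 => boundary z == 0
  end.

Fact incidenceK (q : cell 2) (v : cell 0) :
  \sum_e incidence q e * incidence e v = 0.
Proof.
pose c := tnth (sq_attach q).
pose d (a : cell 0) : int := (v == a)%:Z.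
have adjc k : sq_adj (c k) (c (ordS k)).
  have /andP[cyc _] := sq_attach_cycle q.
  rewrite /c !(tnth_nth (c 0)).
  have /(pathP (c 0)) : path (@sq_adj X) (c 3) (sq_attach q).
    have := cyc; rewrite -(rotr_cycle 1) /c !(tnth_nth (c 0)) /=.
    by case: (sq_attach q) => -[|x1 [|x2 [|x3 [|x4 [|]]]]] //=; rewrite andbT.
  rewrite size_tuple => adj; case: k => -[|[|[|[|//]]]] lt4 /=.
  - by have := adj 1 isT; rewrite /c !(tnth_nth (c 0)).
  - by have := adj 2 isT.
  - by have := adj 3 isT.
  - by have := adj 0 isT; rewrite /= [X in sq_adj X](tnth_nth (c 0)).
have path_stepE a b : sq_adj a b -> \sum_e path_step a b e * incidence e v = d b - d a.
  move=> ab; have neq : a != b.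
    by apply: contraTneq ab => ->; rewrite sq_adj_irr.
  wlog lt_ab : a b ab neq / (enum_rank a < enum_rank b)%N.
    move=> H; case: (ltngtP (enum_rank a) (enum_rank b)) => [|gt|eq]; first exact: H.
      rewrite -[RHS]opprB -(H b a) // 1?sq_adj_sym // 1?eq_sym // -sumrN.
      by apply: eq_bigr => e _; rewrite /path_step -mulNr opprB.
    by move/ord_inj/enum_rank_inj: eq neq => ->; rewrite eqxx.
  have ltP : (enum_rank (a, b).1 < enum_rank (a, b).2)%N && sq_adj (a, b).1 (a, b).2.
    by rewrite lt_ab ab.
  pose e0 : cell 1 := Sub (a, b) ltP.
  rewrite (bigD1 e0) //= big1 ?addr0 => [|e ne0].
    by rewrite /path_step /= eqxx xpair_eqE (negbTE neq) /= subr0 mul1r.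
  rewrite /path_step; have -> : (val e == (a, b)) = false.
    by apply: contraNF ne0 => /eqP ee; apply/eqP/val_inj.
  have -> : (val e == (b, a)) = false; last by rewrite subrr mul0r.
  apply: contraTF (valP e) => /eqP ->.
  by rewrite /= negb_and -leqNgt (ltnW lt_ab).
rewrite /incidence -/c; under eq_bigr do rewrite mulr_suml.
rewrite exchange_big /= (eq_bigr (fun k => d (c (ordS k)) - d (c k))); last first.
  by move=> k _; rewrite -path_stepE.
by rewrite sumrB [X in X - _](reindex_inj (can_inj (@ord_predK 4))) /= (eq_bigr (fun k => d (c k))) ?subrr // => k _; rewrite ord_predK.
Qed.

Fact boundaryK i (c : chain i.+2) : boundary (boundary c) = 0.
Proof.
apply/ffunP => y; rewrite !ffunE.
under eq_bigr do rewrite ffunE mulr_suml.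
rewrite exchange_big big1 // => x _ /=; under eq_bigr do rewrite -mulrA.
rewrite -mulr_sumr; case: i c x y => [|i] c x y; first by rewrite incidenceK mulr0.
by case: x.
Qed.

Fact boundaryB i : zmod_morphism (@boundary i).
Proof.
move=> c d; apply/ffunP => y; rewrite !ffunE -sumrB.
by apply: eq_bigr => x _; rewrite !ffunE mulrBl.
Qed.

Fact is_cycle_zmod i : zmod_closed (@is_cycle i).
Proof.
case: i => [|i]; first by split.
have b0 : @boundary i 0 = 0 by rewrite -(subrr 0) boundaryB subrr.
split; rewrite ?unfold_in /= ?b0 // => c d /eqP c0 /eqP d0.
by rewrite unfold_in /= boundaryB c0 d0 subrr.
Qed.

HB.instance Definition _ i :=
  GRing.isZmodClosed.Build (chain i) (@is_cycle i) (is_cycle_zmod i).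

Record cycle_group (i : nat) :=
  Cycle { cycle_val : chain i; _ : cycle_val \in @is_cycle i }.
HB.instance Definition _ i := [isSub for @cycle_val i].
HB.instance Definition _ i := [Choice of cycle_group i by <:].
HB.instance Definition _ i :=
  [SubChoice_isSubZmodule of cycle_group i by <:].

Definition is_boundary (i : nat) : {pred cycle_group i} :=
  fun z => `[< exists c : chain i.+1, cycle_val z = boundary c >].

Fact is_boundary_zmod i : zmod_closed (@is_boundary i).
Proof.
split=> [|y z].
  by apply/asboolP; exists 0; rewrite -[in RHS](subrr 0) boundaryB subrr.
move=> /asboolP[c yc] /asboolP[d zd]; apply/asboolP; exists (c - d).
by rewrite boundaryB -yc -zd.
Qed.

HB.instance Definition _ i :=
  GRing.isZmodClosed.Build (cycle_group i) (@is_boundary i)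
    (is_boundary_zmod i).

(** [Quotient.quot] is the quotient of an abelian group by a subgroup. *)
Definition homology (i : nat) : zmodType := Quotient.quot (@is_boundary i).

End CellularHomology.

Definition isomorphic (A B : zmodType) : Prop :=
  exists f : {additive A -> B}, bijective f.

Section ConvexPolyhedra.
Variable R : realType.
Local Notation E3 := 'rV[R]_3.

Definition dotp (x y : E3) : R := \sum_i x 0 i * y 0 i.

Definition convex_hull (s : seq E3) : set E3 :=
  [set x | exists w : 'I_(size s) -> R,
    [/\ forall i, 0 <= w i, \sum_i w i = 1 & x = \sum_i w i *: s`_i]].

Definition segment (x y : E3) : set E3 :=
  [set z | exists2 t : R, 0 <= t <= 1 & z = (1 - t) *: x + t *: y].

Record polyhedron := Polyhedron {
  carrier :> set E3;
  carrier_hull : exists s : seq E3, carrier = convex_hull s;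
  carrier_full_dim : carrier° !=set0
}.

(** [dotp u x = c] is a supporting plane of [P], with outer normal [u]. *)
Definition supports (P : set E3) (u : E3) (c : R) : Prop :=
  [/\ u != 0, forall x, P x -> dotp u x <= c & exists2 x, P x & dotp u x = c].

Definition is_face (P F : set E3) : Prop :=
  exists u c, supports P u c /\ F = P `&` [set x | dotp u x = c].

Definition is_vertex (P : set E3) (v : E3) : Prop := is_face P [set v].

(** The parallel supporting planes are those with normal [u] through [x] and
    [y]. *)
Definition antipodal (P : set E3) (x y : E3) : Prop :=
  [/\ P x, P y & exists2 u, u != 0 &
    forall z, P z -> dotp u y <= dotp u z <= dotp u x].

Fact dotpDr u x y : dotp u (x + y) = dotp u x + dotp u y.
Proof. by rewrite /dotp -big_split /=; apply: eq_bigr => i _; rewrite mxE mulrDr. Qed.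

Fact dotpZr u a x : dotp u (a *: x) = a * dotp u x.
Proof. by rewrite /dotp mulr_sumr; apply: eq_bigr => i _; rewrite mxE mulrCA. Qed.

Fact dotp0r u : dotp u 0 = 0.
Proof. by rewrite -(scale0r 0) dotpZr mul0r. Qed.

Fact dotpNl u x : dotp (- u) x = - dotp u x.
Proof. by rewrite /dotp -sumrN; apply: eq_bigr => i _; rewrite mxE mulNr. Qed.

Fact dotp_sumr u n (F : 'I_n -> E3) : dotp u (\sum_i F i) = \sum_i dotp u (F i).
Proof. by apply: (big_morph (dotp u)) => [x y|]; rewrite ?dotpDr ?dotp0r. Qed.

Fact mem_hull (s : seq E3) (i : 'I_(size s)) : convex_hull s s`_i.
Proof.
exists (fun j => (j == i)%:R); split => [j||]; first by rewrite ler0n.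
  by rewrite (bigD1 i) //= eqxx big1 ?addr0 // => j /negbTE ->.
rewrite (bigD1 i) //= eqxx scale1r big1 ?addr0 // => j /negbTE ->.
by rewrite scale0r.
Qed.

Section Polyhedron.
Variable P : polyhedron.

Fact antipodal_sym x y : antipodal P x y -> antipodal P y x.
Proof.
case=> Px Py [u u0 xuy]; split=> //; exists (- u); first by rewrite oppr_eq0.
by move=> z /xuy; rewrite !dotpNl !lerN2 andbC.
Qed.

Fact vertex_mem v : is_vertex P v -> carrier P v.
Proof.
by case=> u [c [_ /seteqP[+ _]]] => /(_ v erefl)[].
Qed.

Fact finite_vertices : finite_set (is_vertex P).
Proof.
have [s Ps] := carrier_hull P.
apply: (@sub_finite_set _ _ [set` s]); last exact: finite_seq.
move=> v vP; have Pv := vertex_mem vP; case: vP => u [c [[u0 le_c _] vE]] /=.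
have uv : dotp u v = c by have /seteqP[/(_ v erefl)[]] := vE.
move: (Pv); rewrite Ps => -[w [w0 w1 vw]].
have term0 i : w i * (c - dotp u s`_i) = 0.
  apply: (psumr_eq0P (P := xpredT) (F := fun i => w i * (c - dotp u s`_i))) => //.
    move=> j _; rewrite mulr_ge0 // subr_ge0 le_c // Ps; exact: mem_hull.
  under eq_bigr do rewrite mulrBr.
  rewrite sumrB -mulr_suml w1 mul1r -[X in X - _]uv vw dotp_sumr.
  by under eq_bigr do rewrite dotpZr; rewrite subrr.
have [i wi] : exists i, w i != 0.
  apply/existsP; rewrite -negb_forall; apply/negP => /forallP wz.
  by move: w1; rewrite big1 => [/eqP|i _]; [rewrite eq_sym oner_eq0 | exact/eqP/wz].
have si : s`_i = v.
  have /seteqP[_ sub] := vE; apply: sub; split => /=.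
    by rewrite Ps; exact: mem_hull.
  by have /eqP := term0 i; rewrite mulf_eq0 (negbTE wi) subr_eq0 => /eqP.
by rewrite -si mem_nth.
Qed.

Definition vertex : finType := fset_set (is_vertex P).

Fact vertexP (v : vertex) : is_vertex P (val v).
Proof. by have := valP v; rewrite in_fset_set ?inE //; exact: finite_vertices. Qed.

Definition is_edge : rel vertex :=
  fun v w => (v != w) && `[< is_face P (segment (val v) (val w)) >].

Definition edge : finType := upair is_edge.

Definition midpoint (e : edge) : E3 :=
  2^-1 *: (val (val e).1 + val (val e).2).

Definition antipodal_vertices : rel vertex :=
  fun v w => (v != w) && `[< antipodal P (val v) (val w) >].

Definition antipodal_edges : rel edge :=
  fun e f => (e != f) && `[< antipodal P (midpoint e) (midpoint f) >].

Definition antipodal_vertex_pair : finType := upair antipodal_vertices.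
Definition antipodal_edge_pair : finType := upair antipodal_edges.

Definition antipodal_defect : int :=
  #|vertex|%:Z - 1 - #|antipodal_vertex_pair|%:Z + #|antipodal_edge_pair|%:Z.

(** The cycle v - w - v' - w' - v for the pair of edges e = vv', f = ww'. *)
Definition square_cycle (q : antipodal_edge_pair) : 4.-tuple vertex :=
  let e := val (val q).1 in let f := val (val q).2 in
  [tuple e.1; f.1; e.2; f.2].

Fact antipodal_vertices_sym : symmetric antipodal_vertices.
Proof.
move=> v w; rewrite /antipodal_vertices eq_sym; congr (_ && _).
by apply/asboolP/asboolP => /antipodal_sym.
Qed.

Fact antipodal_vertices_irr : irreflexive antipodal_vertices.
Proof. by move=> v; rewrite /antipodal_vertices eqxx. Qed.

Fact full_dim u c : u != 0 -> ~ (forall x, carrier P x -> dotp u x = c).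
Proof.
move=> u0 Pc; have [x Px] := carrier_full_dim P.
have cvg_x : (fun t : R => x + t *: u) @ 0 --> x.
  rewrite -{2}[x]addr0 -(scale0r u).
  by apply: cvgD; [exact: cvg_cst | apply: cvgZr_tmp; exact: cvg_id].
have /nbhs_ballP[e /= e0 ball_P] := cvg_x _ Px.
have := ball_P (e / 2); rewrite /ball /= sub0r normrN gtr0_norm ?divr_gt0 //.
rewrite gtr_pMr // invf_lt1 // ltr1n => /(_ isT) /Pc.
rewrite dotpDr (Pc x) ?dotpZr; last exact: interior_subset Px.
move/eqP; rewrite -[X in _ == X]addr0 (inj_eq (addrI _)) mulf_eq0.
rewrite gt_eqF ?divr_gt0 //= => /eqP uu0; move/eqP: u0; apply.
apply/rowP => i; rewrite mxE; apply/eqP; rewrite -sqrf_eq0 expr2; apply/eqP.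
by apply: (psumr_eq0P (P := xpredT) (F := fun i => u 0 i * u 0 i)) => // j _;
  rewrite -expr2 sqr_ge0.
Qed.

Fact square_cycleP (q : antipodal_edge_pair) :
  ucycleb antipodal_vertices (square_cycle q).
Proof.
rewrite /square_cycle; case: q => -[e f] /= /andP[_ /andP[_ /asboolP]].
case=> _ _ [u u0]; rewrite /midpoint !dotpZr !dotpDr.
case: e f => [[v v'] /= /andP[_ /andP[nv _]]] [[w w'] /= /andP[_ /andP[nw _]]] efu.
have inP (x : vertex) : carrier P (fsval x) by exact: vertex_mem (vertexP x).
have := efu _ (inP v); have := efu _ (inP v').
have := efu _ (inP w); have := efu _ (inP w').
have nab : 2^-1 * (dotp u (fsval v) + dotp u (fsval v')) !=
           2^-1 * (dotp u (fsval w) + dotp u (fsval w')).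
  apply/eqP => vw; apply: (full_dim (c := 2^-1 * (dotp u (fsval v) + dotp u (fsval v'))) u0) => z Pz.
  by have := efu z Pz; rewrite -vw => /andP[ge le]; apply/eqP; rewrite eq_le le ge.
move: efu nab.
set a := dotp u (fsval v); set a' := dotp u (fsval v').
set b := dotp u (fsval w); set b' := dotp u (fsval w').
move=> efu nab /andP[h1 h2] /andP[h3 h4] /andP[h5 h6] /andP[h7 h8].
have aa' : a' = a by lra.
have bb' : b' = b by lra.
have ltba : b < a.
  have : a != b by apply: contra nab => /eqP ab; apply/eqP; lra.
  by rewrite neq_lt => /orP[] //; lra.
have anti (x y : vertex) : dotp u (fsval x) = a -> dotp u (fsval y) = b ->
    antipodal_vertices x y.
  move=> xa yb; apply/andP; split.
    by apply: contraTneq ltba => xy; rewrite -xa -yb xy ltxx.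
  apply/asboolP; split; [exact: inP | exact: inP |].
  exists u => // z Pz; rewrite xa yb.
  by have /andP[z1 z2] := efu z Pz; apply/andP; split; lra.
have vw := anti v w erefl erefl; have v'w := anti v' w aa' erefl.
have vw' := anti v w' erefl bb'; have v'w' := anti v' w' aa' bb'.
have neq x y : antipodal_vertices x y -> x != y by case/andP.
apply/andP; split.
  have wv' := v'w; have w'v := vw'.
  rewrite antipodal_vertices_sym in wv'; rewrite antipodal_vertices_sym in w'v.
  change [&& antipodal_vertices v w, antipodal_vertices w v',
    antipodal_vertices v' w', antipodal_vertices w' v & true].
  by rewrite vw wv' v'w' w'v.
rewrite /= !inE !negb_or nv nw (neq _ _ vw) (neq _ _ vw') (neq _ _ v'w').
by rewrite eq_sym (neq _ _ v'w).
Qed.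

(** The antipodal square complex X(P); its 1-skeleton is the antipodal graph. *)
Definition antipodal_square_complex : square_complex :=
  SquareComplex antipodal_vertices_sym antipodal_vertices_irr square_cycleP.

End Polyhedron.
End ConvexPolyhedra.

(* Main.v *)
(* For a nonzero direction u let F(u) be the set of vertices of P maximising
   <u, .>.  The antipodal graph is the union of the complete bipartite graphs
   between F(u) and F(-u).  Since F(u) is connected through edges of P, the
   squares of X(P) generate all four-cycles of these bipartite graphs, so in
   C_1 / B_1 the class c(v, w) of the oriented edge vw splits as a(v) - b(w)
   over each pair (F(u), F(-u)).  The splittings are unique up to a constant and
   restrict to one another as u varies, so cutting R^3 \ 0 into convex cones by
   planes and gluing along connected intersections (the sphere of directions is
   simply connected) gives one splitting c(v, w) = a(v) - b(w) for all antipodal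
   v, w.  As c is antisymmetric, a - b is a constant g with 2g = 0, hence a cycle
   of even total weight bounds.  The same cutting argument shows that the
   bipartite double cover of the graph is connected, i.e. that the graph is
   connected and has an odd closed walk; squares having four sides, the parity of
   the weight identifies H_1 with Z/2.  Finally H_2 = ker d_2 is free, and its
   rank follows from the Euler characteristic. *)

From HB Require Import structures.
Require Import Defs.
From mathcomp Require Import all_boot all_order all_algebra.
From mathcomp Require Import finmap.
From mathcomp Require Import ring lra zify.
From mathcomp Require Import all_classical all_reals all_analysis.

Set Implicit Arguments.
Unset Strict Implicit.
Unset Printing Implicit Defensive.

Import Order.TTheory GRing.Theory Num.Theory.

Local Open Scope quotient_scope.
Local Open Scope ring_scope.

(** * Piecewise constant functions on cones of directions *)

Section InnerProduct.
Variable R : realType.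
Local Notation E3 := 'rV[R]_3.
Implicit Types u v x y : E3.

Lemma dotpC x y : dotp x y = dotp y x.
Proof. by apply: eq_bigr => i _; rewrite mulrC. Qed.

Lemma dotpDl x y u : dotp (x + y) u = dotp x u + dotp y u.
Proof. by rewrite dotpC dotpDr !(dotpC u). Qed.

Lemma dotpZl a x u : dotp (a *: x) u = a * dotp x u.
Proof. by rewrite dotpC dotpZr (dotpC u). Qed.

Lemma dotpNr u x : dotp u (- x) = - dotp u x.
Proof. by rewrite dotpC dotpNl dotpC. Qed.

Lemma dotpBr u x y : dotp u (x - y) = dotp u x - dotp u y.
Proof. by rewrite dotpDr dotpNr. Qed.

Lemma dotpBl x y u : dotp (x - y) u = dotp x u - dotp y u.
Proof. by rewrite dotpC dotpBr !(dotpC u). Qed.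

Lemma dotp0l u : dotp 0 u = 0.
Proof. by rewrite dotpC dotp0r. Qed.

Lemma dotpp_ge0 x : 0 <= dotp x x.
Proof. by apply: sumr_ge0 => i _; rewrite -expr2 sqr_ge0. Qed.

Lemma dotpp_eq0 x : (dotp x x == 0) = (x == 0).
Proof.
apply/eqP/eqP => [x0|->]; last by rewrite dotp0r.
apply/rowP => i; rewrite mxE; apply/eqP; rewrite -sqrf_eq0 expr2; apply/eqP.
by apply: (psumr_eq0P (P := xpredT) (F := fun i => x 0 i * x 0 i)) => // j _;
  rewrite -expr2 sqr_ge0.
Qed.

Lemma dotpp_gt0 x : x != 0 -> 0 < dotp x x.
Proof. by move=> x0; rewrite lt_neqAle eq_sym dotpp_eq0 x0 dotpp_ge0. Qed.

Lemma exists_orthogonal x y : exists2 u, u != 0 & dotp u x = 0 /\ dotp u y = 0.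
Proof.
pose M : 'M[R]_(3, 2) := \matrix_(i, j) (if j == 0 then x 0 i else y 0 i).
have kM : kermx M != 0.
  by rewrite -mxrank_eq0 mxrank_ker -lt0n subn_gt0 (leq_ltn_trans (rank_leq_col M)).
have [i rowi] : exists i, row i (kermx M) != 0.
  apply/existsP; rewrite -negb_forall; apply: contra kM => /forallP z.
  by apply/eqP/row_matrixP => i; rewrite row0; exact/eqP/z.
exists (row i (kermx M)) => //.
have uM : row i (kermx M) *m M = 0 by rewrite -row_mul mulmx_ker row0.
split.
  have /rowP/(_ 0) := uM; rewrite !mxE => <-.
  by apply: eq_bigr => j _; rewrite !mxE.
have /rowP/(_ 1) := uM; rewrite !mxE => <-.
by apply: eq_bigr => j _; rewrite !mxE.
Qed.

Lemma dotp_delta i (u : E3) : dotp (delta_mx 0 i) u = u 0 i.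
Proof.
rewrite /dotp (bigD1 i) //= mxE !eqxx mul1r big1 ?addr0 // => j /negbTE ji.
by rewrite mxE ji andbF mul0r.
Qed.

End InnerProduct.

(** * Maximising vertices of a direction, and functions constant over a set of directions *)

Section Directions.
Variables (R : realType) (W : finType) (pos : W -> 'rV[R]_3).
Local Notation E3 := 'rV[R]_3.
Implicit Types (u d : E3) (v w : W) (S : E3 -> Prop).

Definition top u : pred W := fun v => [forall w, dotp u (pos w) <= dotp u (pos v)].

Lemma topP u v : reflect (forall w, dotp u (pos w) <= dotp u (pos v)) (top u v).
Proof. exact: forallP. Qed.

Lemma top_eq u v w : top u v -> top u w -> dotp u (pos v) = dotp u (pos w).
Proof. by move=> /topP tv /topP tw; apply: le_anti; rewrite tv tw. Qed.

Lemma top_comb u d (s t : R) v : 0 <= s -> 0 <= t -> top u v -> top d v ->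
  top (s *: u + t *: d) v.
Proof.
move=> s0 t0 /topP uv /topP dv; apply/topP => w.
by rewrite !dotpDl !dotpZl lerD // ler_wpM2l.
Qed.

Lemma top_scale u (s : R) v : 0 <= s -> top u v -> top (s *: u) v.
Proof. by move=> s0 uv; have := top_comb s0 (lexx 0) uv uv; rewrite scale0r addr0. Qed.

Definition cone S := forall u d (s t : R), S u -> S d -> 0 < s -> 0 < t ->
  S (s *: u + t *: d).

(** Closure is asked only for combinations that do not cancel, so that space, half-spaces, planes
    and half-planes without the origin all qualify. *)
Definition punctured_cone S := (forall u, S u -> u != 0) /\
  forall u d (s t : R), S u -> S d -> 0 < s -> 0 < t -> s *: u + t *: d != 0 ->
  S (s *: u + t *: d).

Definition below S d u := S u /\ dotp d u <= 0.
Definition on_plane S d u := S u /\ dotp d u = 0.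

Lemma cone_below S d : cone S -> cone (below S d).
Proof.
move=> cS u1 u2 s t [S1 d1] [S2 d2] s0 t0; split; first exact: cS.
by rewrite dotpDr !dotpZr; nra.
Qed.

Lemma cone_on_plane S d : cone S -> cone (on_plane S d).
Proof.
move=> cS u1 u2 s t [S1 d1] [S2 d2] s0 t0; split; first exact: cS.
by rewrite dotpDr !dotpZr d1 d2 !mulr0 addr0.
Qed.

(* The order in which [u] sorts the points can change over [S] only across the
   planes orthogonal to the vectors of [ds]. *)
Definition sorted_off S (ds : seq E3) := forall v w, pos v - pos w \in ds \/
  ((forall u, S u -> dotp u (pos v) <= dotp u (pos w)) \/
   (forall u, S u -> dotp u (pos w) <= dotp u (pos v))).

Lemma sorted_off_below S d ds : sorted_off S (d :: ds) -> sorted_off (below S d) ds.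
Proof.
move=> so v w; case: (so v w) => [|[] h]; first rewrite inE => /orP[/eqP <-|]; first last.
- by right; right => u [/h].
- by right; left => u [/h].
- by left.
by right; left => u [_]; rewrite dotpC dotpBr subr_le0.
Qed.

Lemma sorted_off_above S d ds : sorted_off S (d :: ds) -> sorted_off (below S (- d)) ds.
Proof.
move=> so v w; case: (so v w) => [|[] h]; first rewrite inE => /orP[/eqP <-|]; first last.
- by right; right => u [/h].
- by right; left => u [/h].
- by left.
by right; right => u [_]; rewrite dotpNl dotpC dotpBr oppr_le0 subr_ge0.
Qed.

Lemma sorted_off_all S : exists ds, sorted_off S ds.
Proof.
by exists [seq pos v - pos w | v <- enum W, w <- enum W] => v w; left;
  apply: allpairs_f; rewrite mem_enum.
Qed.

(** With no cutting vector left, all of [S] orders any two points the same way, so a running maximum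
    along the enumeration serves every direction at once. *)
Lemma common_top S : sorted_off S [::] -> W ->
  exists v, forall u, S u -> top u v.
Proof.
move=> so w0.
suff [v hv] : exists v, forall w, w \in w0 :: enum W -> forall u, S u ->
    dotp u (pos w) <= dotp u (pos v).
  by exists v => u Su; apply/topP => w; apply: hv; rewrite // inE mem_enum orbT.
elim: (enum W) => [|w1 s [v IH]].
  by exists w0 => w; rewrite inE => /eqP -> u _.
case: (so v w1) => [//|[] le_v]; [exists w1 | exists v] => w.
  rewrite !inE orbCA => /orP[/eqP -> u _ //|ws u Su].
  by apply: le_trans (le_v u Su); apply: IH; rewrite ?inE.
rewrite !inE orbCA => /orP[/eqP -> u Su|ws u Su]; first exact: le_v.
by apply: IH; rewrite ?inE.
Qed.

Lemma exists_top u : W -> exists v, top u v.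
Proof.
move=> w0; have [|v hv] := @common_top (eq u) _ w0; last by exists v; exact: hv.
move=> v w; right; case: (leP (dotp u (pos v)) (dotp u (pos w))) => h; [left|right] => _ <- //.
exact: ltW.
Qed.

Definition agrees (T : Type) S (p : W -> T) :=
  forall u v w, S u -> top u v -> top u w -> p v = p w.

Definition constant_over (T : Type) S (p : W -> T) :=
  forall u d v w, S u -> S d -> top u v -> top d w -> p v = p w.

Lemma cone_crossing S d u1 u2 : cone S -> S u1 -> S u2 -> dotp d u1 <= 0 -> 0 <= dotp d u2 ->
  exists2 u, S u & dotp d u = 0.
Proof.
move=> cS S1 S2; rewrite le_eqVlt => /orP[/eqP d1 _|d1]; first by exists u1.
rewrite le_eqVlt => /orP[/eqP d2|d2]; first by exists u2.
exists (dotp d u2 *: u1 + - dotp d u1 *: u2); first by apply: cS; rewrite ?oppr_gt0.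
by rewrite dotpDr !dotpZr; ring.
Qed.

(** Induction on the cutting vectors: the plane orthogonal to [d] cuts [S] into two cones. If both
    are inhabited, convexity gives a direction on the plane, and a maximiser there ties the two
    constants together. *)
Lemma cone_constant (T : Type) S (p : W -> T) : cone S -> agrees S p -> constant_over S p.
Proof.
move=> cS ag; have [ds so] := sorted_off_all S.
elim: ds S cS ag so => [|d ds IH] S cS ag so.
  move=> u1 u2 v w S1 S2 v1 w2; have [x hx] := common_top so v.
  by rewrite (ag _ _ _ S1 v1 (hx _ S1)) (ag _ _ _ S2 w2 (hx _ S2)).
have agb e : agrees (below S e) p by move=> u v w [/ag h _]; exact: h.
have cb := IH _ (cone_below cS) (agb _) (sorted_off_below so).
have ca := IH _ (cone_below cS) (agb _) (sorted_off_above so).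
suff mixed u1 u2 v w : S u1 -> S u2 -> top u1 v -> top u2 w ->
    dotp d u1 <= 0 -> 0 <= dotp d u2 -> p v = p w.
  move=> u1 u2 v w S1 S2 v1 w2.
  case: (leP (dotp d u1) 0) => d1; case: (leP (dotp d u2) 0) => d2.
  - exact: (cb u1 u2).
  - exact: (mixed u1 u2 v w S1 S2 v1 w2 d1 (ltW d2)).
  - by rewrite (mixed u2 u1 w v S2 S1 w2 v1 d2 (ltW d1)).
  - by apply: (ca u1 u2) => //; split; rewrite // dotpNl oppr_le0 ltW.
move=> S1 S2 v1 w2 d1 d2; have [u Su du] := cone_crossing cS S1 S2 d1 d2.
have [x ux] := exists_top u v.
rewrite (cb u1 u v x) //; last by split; rewrite // du.
by apply: (ca u u2) => //; split; rewrite // dotpNl ?du ?oppr0 ?oppr_le0.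
Qed.

(** The convex cone spanned by [u1] and [u2], without its apex, lies in [S], so the convex case
    applies to it. *)
Lemma segment_cone_constant (T : Type) S (p : W -> T) u1 u2 v w :
  punctured_cone S -> agrees S p -> S u1 -> S u2 ->
  (forall s t, 0 < s -> 0 < t -> s *: u1 + t *: u2 != 0) ->
  top u1 v -> top u2 w -> p v = p w.
Proof.
move=> [S0 cS] ag S1 S2 nz v1 w2.
pose S' u := exists s t, [/\ 0 <= s, 0 <= t, 0 < s + t & u = s *: u1 + t *: u2].
have S'S u : S' u -> S u.
  have ZS a x : S x -> 0 < a -> S (a *: x).
    (* Closure is available only for two positive weights, hence the halving. *)
    move=> Sx a0; have h : a *: x = (a / 2) *: x + (a / 2) *: x.
      by rewrite -scalerDl -splitr.
    rewrite h; apply: cS; rewrite ?divr_gt0 // -h scaler_eq0 negb_or gt_eqF //=.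
    exact: S0.
  move=> [s [t [s0 t0 st ->]]]; move: s0 t0 st.
  rewrite le_eqVlt => /orP[/eqP <-|s0]; first by rewrite add0r scale0r add0r => _; exact: ZS.
  rewrite le_eqVlt => /orP[/eqP <-|t0 _]; first by rewrite addr0 scale0r addr0; exact: ZS.
  by apply: cS => //; exact: nz.
have cS' : cone S'.
  move=> _ _ s t [a [b [a0 b0 ab ->]]] [c [e [c0 e0 ce ->]]] s0 t0.
  exists (s * a + t * c), (s * b + t * e).
  split; [by nra|by nra|by nra|].
  by rewrite !scalerDr !scalerA !scalerDl addrACA.
apply: (cone_constant cS' (p := p)) v1 w2.
- by move=> u x y /S'S; exact: ag.
- by exists 1, 0; rewrite scale1r scale0r !addr0.
- by exists 0, 1; rewrite scale1r scale0r !add0r.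
Qed.

(** Only opposite directions cannot be joined by a segment off the origin; those are joined through
    a direction of [S] orthogonal to both. *)
Lemma punctured_cone_constant (T : Type) S (p : W -> T) : punctured_cone S ->
  (forall u, S u -> exists2 d, S d & dotp u d = 0) ->
  agrees S p -> constant_over S p.
Proof.
move=> pS orth ag u1 u2 v w S1 S2 v1 w2; have [S0 _] := pS.
have [|/existsNP[s /existsNP[t]]] :=
    pselect (forall s t, 0 < s -> 0 < t -> s *: u1 + t *: u2 != 0).
  by move=> nz; exact: (segment_cone_constant pS ag S1 S2 nz v1 w2).
move=> /not_implyP[s0] /not_implyP[t0] /negP; rewrite negbK => /eqP st0.
have [d Sd ud] := orth _ S1; have [x dx] := exists_top d v.
have u2d : dotp u2 d = 0.
  have := congr1 (dotp d) st0; rewrite dotpDr !dotpZr dotp0r !(dotpC d) ud mulr0 add0r.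
  by move/eqP; rewrite mulf_eq0 gt_eqF //= => /eqP.
have indep a b : S a -> S b -> dotp a b = 0 ->
    forall s t, 0 < s -> 0 < t -> s *: a + t *: b != 0.
  move=> Sa Sb ab s' t' s'0 t'0; apply/eqP => /(congr1 (dotp a)).
  rewrite dotpDr !dotpZr ab dotp0r mulr0 addr0 => /eqP.
  by rewrite mulf_eq0 dotpp_eq0 (negbTE (S0 _ Sa)) gt_eqF.
rewrite (segment_cone_constant pS ag S1 Sd _ v1 dx); last exact: indep.
by apply: (segment_cone_constant pS ag Sd S2 _ dx w2); apply: indep => //; rewrite dotpC.
Qed.

End Directions.

(** * Splitting a cocycle over all directions *)

Section Splitting.
Variables (R : realType) (W : finType) (pos : W -> 'rV[R]_3).
Variables (A : zmodType) (c : W -> W -> A).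
Local Notation E3 := 'rV[R]_3.
Local Notation top := (top pos).
Implicit Types (u d : E3) (v w : W) (S : E3 -> Prop).

Hypothesis flat : forall u v, u != 0 -> top u v -> top (- u) v -> False.
(** For antisymmetric [c] this is the total of [c] along the closed walk v - w - v' - w' - v. *)
Hypothesis cocycle : forall u v v' w w', u != 0 -> top u v -> top u v' ->
  top (- u) w -> top (- u) w' -> c v w - c v' w + c v' w' - c v w' = 0.

Definition splits_over S := exists a b : W -> A,
  forall u v w, S u -> top u v -> top (- u) w -> c v w = a v - b w.

(** A cancelling combination would make [v] maximal both for [t *: u2] and for its opposite, against
    [flat]. *)
Lemma top_not_opposite u1 u2 v s t : u2 != 0 -> top u1 v -> top u2 v -> 0 < s -> 0 < t ->
  s *: u1 + t *: u2 != 0.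
Proof.
move=> u20 v1 v2 s0 t0; apply/negP; rewrite addr_eq0 => /eqP e.
apply: (@flat (t *: u2) v); rewrite -?e ?scaler_eq0 ?gt_eqF //=.
  exact: top_scale (ltW t0) v2.
exact: top_scale (ltW s0) v1.
Qed.

Lemma punctured_crossing S d u1 u2 : punctured_cone S ->
  (forall s t, 0 < s -> 0 < t -> s *: u1 + t *: u2 != 0) ->
  below S d u1 -> below S (- d) u2 ->
  exists s t, [/\ 0 <= s, 0 <= t & on_plane S d (s *: u1 + t *: u2)].
Proof.
move=> [_ cS] nz [S1 d1] [S2]; rewrite dotpNl oppr_le0 => d2.
move: d1; rewrite le_eqVlt => /orP[/eqP d1|d1].
  by exists 1, 0; rewrite scale1r scale0r addr0.
move: d2; rewrite le_eqVlt => /orP[/eqP d2|d2].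
  by exists 0, 1; rewrite scale1r scale0r add0r.
exists (dotp d u2), (- dotp d u1); split; [exact: ltW | by rewrite oppr_ge0 ltW |].
split; last by rewrite dotpDr !dotpZr; ring.
by apply: cS; rewrite ?oppr_gt0 //; apply: nz; rewrite ?oppr_gt0.
Qed.

(* Two splittings differ by a constant over the common boundary plane; after
   subtracting it they agree there, and a vertex maximal on both sides of the
   plane is maximal somewhere on the plane. *)
Lemma splits_glue S d : punctured_cone S ->
  (forall p : W -> A, agrees pos (on_plane S d) p -> constant_over pos (on_plane S d) p) ->
  splits_over (below S d) -> splits_over (below S (- d)) -> splits_over S.
Proof.
move=> pS const [a1 [b1 h1]] [a2 [b2 h2]]; have [S0 _] := pS.
have diff u v w : on_plane S d u -> top u v -> top (- u) w -> a1 v - a2 v = b1 w - b2 w.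
  move=> [Su du] uv uw; have e1 : c v w = a1 v - b1 w by apply: h1 uv uw; split; rewrite ?du.
  have e2 : c v w = a2 v - b2 w by apply: h2 uv uw; split; rewrite // dotpNl du oppr0.
  have -> : a1 v = c v w + b1 w by rewrite e1 subrK.
  have -> : a2 v = c v w + b2 w by rewrite e2 subrK.
  by rewrite opprD addrACA subrr add0r.
have [k [ka kb]] : exists k, (forall u v, on_plane S d u -> top u v -> a1 v = a2 v + k) /\
    (forall u w, on_plane S d u -> top (- u) w -> b1 w = b2 w + k).
  have [[u0 I0]|noI] := pselect (exists u, on_plane S d u); last first.
    by exists 0; split=> u x Iu; case: noI; exists u.
  have [[v0]|noW] := pselect (inhabited W); last first.
    by exists 0; split=> u x; case: noW.
  (* Over the maximisers of one [u], this difference equals that of [b1] and [b2] at any fixed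
     maximiser of [- u], so it does not vary. *)
  have cst : constant_over pos (on_plane S d) (fun v => a1 v - a2 v).
    apply: const => u v w Iu uv uw; have [x ux] := exists_top pos (- u) v.
    by rewrite (diff u v x) // (diff u w x).
  have {v0}[v0 uv0] := exists_top pos u0 v0.
  exists (a1 v0 - a2 v0); split=> u x Iu ux.
    by rewrite (cst _ _ _ _ I0 Iu uv0 ux) addrC subrK.
  have [y uy] := exists_top pos u x.
  by rewrite (cst _ _ _ _ I0 Iu uv0 uy) (diff u y x) // addrC subrK.
pose inA v := `[< exists u, below S d u /\ top u v >].
pose inB w := `[< exists u, below S d u /\ top (- u) w >].
(* A vertex used anywhere on the first side keeps the first splitting; all others get the shifted
   second one. *)
exists (fun v => if inA v then a1 v else a2 v + k).
exists (fun w => if inB w then b1 w else b2 w + k).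
move=> u v w Su uv uw; have [du|du] := leP (dotp d u) 0.
  have Su1 : below S d u by [].
  rewrite !ifT; [exact: h1 uv uw | |]; apply/asboolP; by exists u.
have Su2 : below S (- d) u by split; rewrite // dotpNl oppr_le0 ltW.
have -> : (if inA v then a1 v else a2 v + k) = a2 v + k.
  case: ifP => // /asboolP[u1 [Su1 u1v]].
  have [|s [t [s0 t0 I]]] := punctured_crossing pS _ Su1 Su2.
    by move=> s t s0 t0; apply: (top_not_opposite _ u1v uv) => //; exact: S0.
  by apply: (ka _ _ I); exact: top_comb.
have -> : (if inB w then b1 w else b2 w + k) = b2 w + k.
  case: ifP => // /asboolP[u1 [Su1 u1w]].
  have [|s [t [s0 t0 I]]] := punctured_crossing pS _ Su1 Su2.
    move=> s t s0 t0; rewrite -oppr_eq0 opprD -!scalerN.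
    by apply: (top_not_opposite _ u1w uw) => //; rewrite oppr_eq0; exact: S0.
  apply: (kb _ _ I); rewrite opprD -!scalerN; exact: top_comb.
rewrite (h2 _ _ _ Su2 uv uw) opprD addrACA subrr addr0 //.
Qed.

Lemma cone_punctured S : (forall u, S u -> u != 0) -> cone S -> punctured_cone S.
Proof. by move=> S0 cS; split=> // u d s t Su Sd s0 t0 _; exact: cS. Qed.

Lemma sorted_offN S ds : sorted_off pos S ds ->
  sorted_off pos (fun u => S (- u)) ds.
Proof.
move=> so v w; case: (so v w) => [|[] h]; [by left| right; right | right; left];
  by move=> u /h; rewrite !dotpNl lerN2.
Qed.

Lemma cone_splits S : (forall u, S u -> u != 0) -> cone S -> splits_over S.
Proof.
move=> S0 cS; have [ds so] := sorted_off_all pos S.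
elim: ds S S0 cS so => [|d ds IH] S S0 cS so.
  have [[v0]|noW] := pselect (inhabited W); last first.
    by exists (fun=> 0), (fun=> 0) => u v; case: noW.
  have [x hx] := common_top so v0; have [y hy] := common_top (sorted_offN so) v0.
  (* [x] and [y] maximise [u] and [- u] for all [u] in [S] and serve as base points: the cocycle
     identity for [v], [x], [w], [y] gives [c v w]. *)
  exists (fun v => c v y), (fun w => c x y - c x w) => u v w Su uv uw.
  have uy : top (- u) y by apply: hy; rewrite opprK.
  have := cocycle (S0 _ Su) uv (hx _ Su) uw uy.
  move/eqP; rewrite subr_eq0 => /eqP <-.
  by rewrite opprB (addrC (c x w)) addrA addrK subrK.
apply: (@splits_glue S d (cone_punctured S0 cS)).
- by move=> p; apply: cone_constant; exact: cone_on_plane.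
- by apply: IH => [u [/S0]||]; [|exact: cone_below|exact: sorted_off_below].
- by apply: IH => [u [/S0]||]; [|exact: cone_below|exact: sorted_off_above].
Qed.

Lemma punctured_below S d : punctured_cone S -> punctured_cone (below S d).
Proof.
move=> [S0 cS]; split=> [u [/S0]//|u1 u2 s t [S1 d1] [S2 d2] s0 t0 nz].
by split; [exact: cS | rewrite dotpDr !dotpZr; nra].
Qed.

Lemma punctured_on_plane S d : punctured_cone S -> punctured_cone (on_plane S d).
Proof.
move=> [S0 cS]; split=> [u [/S0]//|u1 u2 s t [S1 d1] [S2 d2] s0 t0 nz].
by split; [exact: cS | rewrite dotpDr !dotpZr d1 d2 !mulr0 addr0].
Qed.

(** * Cutting the punctured space down to octants *)

Definition nonzero (u : E3) : Prop := u != 0.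

Lemma punctured_nonzero : punctured_cone nonzero.
Proof. by []. Qed.

(** If a combination cancels, each form, nonpositive at both ends, vanishes at [u1], and
    independence makes [u1] zero. Octants are therefore genuine cones. *)
Lemma octant_not_opposite d1 d2 d3 :
  (forall u, dotp d1 u = 0 -> dotp d2 u = 0 -> dotp d3 u = 0 -> u = 0) ->
  forall u1 u2 (s t : R), below (below (below nonzero d1) d2) d3 u1 ->
  below (below (below nonzero d1) d2) d3 u2 -> 0 < s -> 0 < t -> s *: u1 + t *: u2 != 0.
Proof.
move=> indep u1 u2 s t [[[u10 a1] b1] e1] [[[_ a2] b2] e2] s0 t0.
apply: contra u10 => /eqP opp; apply/eqP.
have neg0 (d : E3) : dotp d u1 <= 0 -> dotp d u2 <= 0 -> dotp d u1 = 0.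
  by have := congr1 (dotp d) opp; rewrite dotpDr !dotpZr dotp0r; nra.
by apply: indep; exact: neg0.
Qed.

Lemma quadrant_splits d1 d2 d3 :
  (forall u, dotp d1 u = 0 -> dotp d2 u = 0 -> dotp d3 u = 0 -> u = 0) ->
  splits_over (below (below nonzero d1) d2).
Proof.
move=> indep; have pQ := punctured_below d2 (punctured_below d1 punctured_nonzero).
have cO e : (forall u, dotp d1 u = 0 -> dotp d2 u = 0 -> dotp e u = 0 -> u = 0) ->
    cone (below (below (below nonzero d1) d2) e).
  move=> ind u1 u2 s t S1 S2 s0 t0.
  by apply: (punctured_below e pQ).2 => //; exact: octant_not_opposite S1 S2 s0 t0.
have indN u : dotp d1 u = 0 -> dotp d2 u = 0 -> dotp (- d3) u = 0 -> u = 0.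
  by rewrite dotpNl => u1 u2 /eqP; rewrite oppr_eq0 => /eqP; exact: indep.
have O0 e u : below (below (below nonzero d1) d2) e u -> u != 0 by case=> -[[]].
apply: (@splits_glue _ d3 pQ) => [p||].
- apply: cone_constant => u1 u2 s t S1 S2 s0 t0.
  apply: (punctured_on_plane d3 pQ).2 => //.
  have [Q1 e1] := S1; have [Q2 e2] := S2.
  by apply: (octant_not_opposite indep) s0 t0; split; rewrite ?e1 ?e2.
- by apply: cone_splits; [exact: O0 | exact: cO].
- by apply: cone_splits; [exact: O0 | exact: cO].
Qed.

(** The cut along [d2] leaves two quadrants. Their common wall is a half-plane without the origin,
    which contains opposite directions, so the punctured form of constancy is needed. *)
Lemma half_space_splits d1 d2 d3 :
  (forall u, dotp d1 u = 0 -> dotp d2 u = 0 -> dotp d3 u = 0 -> u = 0) ->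
  splits_over (below nonzero d1).
Proof.
move=> indep; have pH := punctured_below d1 punctured_nonzero.
apply: (@splits_glue _ d2 pH) => [p||].
- apply: punctured_cone_constant => [|u [[u0 u1] u2]]; first exact: punctured_on_plane.
  (* A vector orthogonal to [u] and [d2] stays on the wall, and it or its opposite lies in the
     half-space. *)
  have [x x0 [xu xd]] := exists_orthogonal u d2.
  have [x1|x1] := leP (dotp d1 x) 0.
    by exists x; [split; rewrite // dotpC | rewrite dotpC].
  exists (- x); last by rewrite dotpNr dotpC xu oppr0.
  split; last by rewrite dotpNr dotpC xd oppr0.
  by split; [rewrite /nonzero oppr_eq0 | rewrite dotpNr oppr_le0 ltW].
- exact: quadrant_splits indep.
- apply: (@quadrant_splits _ _ d3) => u u1; rewrite dotpNl => /eqP.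
  by rewrite oppr_eq0 => /eqP; exact: indep.
Qed.

(** The two half-spaces meet in a punctured plane, which is connected; in dimension two the wall
    would be a disconnected punctured line. *)
Theorem nonzero_splits : splits_over nonzero.
Proof.
pose d i : E3 := delta_mx 0 i.
have indep u : dotp (d 0) u = 0 -> dotp (d 1) u = 0 -> dotp (d 2) u = 0 -> u = 0.
  rewrite !dotp_delta => u0 u1 u2; apply/rowP => i; rewrite mxE.
  case: i => -[|[|[|//]]] lti; [rewrite -[RHS]u0|rewrite -[RHS]u1|rewrite -[RHS]u2];
    by congr (u 0 _); apply: val_inj.
apply: (@splits_glue _ (d 0) punctured_nonzero) => [p||].
- apply: punctured_cone_constant => [|u [u0 u1]]; first exact: punctured_on_plane.
  have [x x0 [xu xd]] := exists_orthogonal u (d 0).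
  by exists x; [split; rewrite // dotpC | rewrite dotpC].
- exact: half_space_splits indep.
- apply: (@half_space_splits _ (d 1) (d 2)) => u; rewrite dotpNl => /eqP.
  by rewrite oppr_eq0 => /eqP; exact: indep.
Qed.

End Splitting.

(** * Vertices and edges of a polyhedron *)

Section PolyhedronVertices.
Variable R : realType.
Local Notation E3 := 'rV[R]_3.

Lemma perturbation (W : finType) (pos : W -> E3) (u d : E3) : exists2 e : R, 0 < e &
  forall v w, dotp u (pos v) < dotp u (pos w) ->
    dotp (u + e *: d) (pos v) < dotp (u + e *: d) (pos w).
Proof.
pose L := [seq (dotp u (pos w) - dotp u (pos v), dotp d (pos w) - dotp d (pos v))
          | v <- enum W, w <- enum W].
(* Stated for all smaller [f] so that the induction may shrink [e]. *)
suff [e e0 he] : exists2 e : R, 0 < e & forall f, 0 < f <= e -> forall p, p \in L ->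
    0 < p.1 -> 0 < p.1 + f * p.2.
  exists e => // v w; rewrite -subr_gt0 => uvw; rewrite -subr_gt0 !dotpDl !dotpZl.
  have := he e; rewrite e0 lexx => /(_ isT _ (allpairs_f _ (mem_enum _ v) (mem_enum _ w))).
  by move=> /(_ uvw) /=; rewrite mulrBr; lra.
elim: L => [|[a b] L [e e0 IH]]; first by exists 1.
have [a0|a0] := ltP 0 a; last first.
  exists e => // f fe p; rewrite inE => /orP[/eqP ->/=|]; last exact: IH.
  by rewrite ltNge a0.
have b1 : 0 < 1 + `|b| by rewrite ltr_wpDr.
(* The second bound gives f (1 + |b|) <= a, hence a + f b >= f > 0. *)
exists (Num.min e (a / (1 + `|b|))); first by rewrite lt_min e0 divr_gt0.
move=> f /andP[f0]; rewrite le_min ler_pdivlMr // => /andP[fe fa] p.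
rewrite inE => /orP[/eqP -> _ /=|pL]; last by apply: IH; rewrite ?f0.
have : - `|b| <= b by rewrite lerNnormlW.
nra.
Qed.

Lemma hull_le (s : seq E3) (n z : E3) (k : R) : (forall i : 'I_(size s), dotp n s`_i <= k) ->
  convex_hull s z -> dotp n z <= k.
Proof.
move=> le_k [w [w0 w1 ->]]; rewrite dotp_sumr -[k]mul1r -w1 mulr_suml.
by apply: ler_sum => i _; rewrite dotpZr ler_wpM2l.
Qed.

(** The weighted gaps to the maximum are nonnegative and sum to zero, so only generators equal to
    [y] carry weight. *)
Lemma hull_exposed (s : seq E3) (n z : E3) (y : E3) :
  (forall i : 'I_(size s), dotp n s`_i <= dotp n y) ->
  (forall i : 'I_(size s), dotp n s`_i = dotp n y -> s`_i = y) ->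
  convex_hull s z -> dotp n z = dotp n y -> z = y.
Proof.
move=> le_y eq_y [w [w0 w1 ->]] nz.
have term0 i : w i * (dotp n y - dotp n s`_i) = 0.
  apply: (psumr_eq0P (P := xpredT) (F := fun i => w i * (dotp n y - dotp n s`_i))) => //.
    by move=> j _; rewrite mulr_ge0 // subr_ge0.
  under eq_bigr do rewrite mulrBr.
  rewrite sumrB -mulr_suml w1 mul1r -[X in X - _]nz dotp_sumr.
  by under eq_bigr do rewrite dotpZr; rewrite subrr.
rewrite -[RHS]scale1r -w1 scaler_suml; apply: eq_bigr => i _.
have /eqP := term0 i; rewrite mulf_eq0 => /orP[/eqP ->|]; first by rewrite !scale0r.
by rewrite subr_eq0 => /eqP /esym/eq_y ->.
Qed.

Variable P : polyhedron R.
Local Notation pos := (fun v : vertex P => val v : E3).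

Lemma carrier_vertex (v : vertex P) : carrier P (val v).
Proof. exact: vertex_mem (vertexP v). Qed.

Lemma vertex_val (x : E3) : is_vertex P x -> exists v : vertex P, val v = x.
Proof.
move=> xv; have xin : x \in fset_set (is_vertex P).
  by rewrite in_fset_set ?inE //; exact: finite_vertices.
by exists [` xin]%fset.
Qed.

Lemma not_singleton (x : E3) : ~ (forall z, carrier P z -> z = x).
Proof.
move=> Px; apply: (@full_dim _ P (delta_mx 0 0) (dotp (delta_mx 0 0) x)).
  by apply/eqP => /matrixP/(_ 0 0); rewrite !mxE eqxx => /eqP; rewrite oner_eq0.
by move=> z /Px ->.
Qed.

(** The carrier is a hull of arbitrary generators, whereas a vertex is a one-point face; this bridge
    lets maximality be tested on vertices alone. *)
Theorem max_at_vertex (u : E3) : exists v : vertex P,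
  forall z, carrier P z -> dotp u z <= dotp u (val v).
Proof.
have [s Ps] := carrier_hull P; pose ps (i : 'I_(size s)) := s`_i.
have [i0] : inhabited 'I_(size s).
  have [x Px] := carrier_full_dim P; have := interior_subset Px.
  rewrite Ps => -[w [_ w1 _]]; case: (posnP (size s)) => [sz|sz]; last first.
    by constructor; exact: Ordinal sz.
  move: w1; rewrite big1 => [/eqP|i]; first by rewrite eq_sym oner_eq0.
  by have := ltn_ord i; rewrite {2}sz.
have [i1 ti1] := exists_top ps u i0.
(* A point of the face farthest from the origin is exposed in the face: it is
   the unique maximiser there of the linear form it defines. *)
have [y ty ymax] := @arg_maxP _ _ _ i1 (top ps u) (fun i => dotp (ps i) (ps i)) ti1.
have yexp i : top ps u i -> ps i != ps y -> dotp (ps y) (ps i) < dotp (ps y) (ps y).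
  move=> ti iy; have := ymax _ ti => le_y.
  have : 0 < dotp (ps y - ps i) (ps y - ps i) by rewrite dotpp_gt0 // subr_eq0 eq_sym.
  rewrite dotpBr !dotpBl (dotpC (ps i) (ps y)).
  by move: le_y; rewrite /=; lra.
(* Tilting [u] towards [ps y] breaks the ties among maximising generators and, for small [e],
   promotes no other generator. *)
have [e e0 he] := perturbation ps u (ps y).
pose n := u + e *: ps y.
have nlt i : ps i != ps y -> dotp n (ps i) < dotp n (ps y).
  move=> iy; have [ti|nti] := boolP (top ps u i).
    rewrite !dotpDl !dotpZl (top_eq ti ty) ltrD2l ltr_pM2l //; exact: yexp.
  apply: he; move/topP: ty => ty; rewrite lt_neqAle ty andbT.
  by apply: contra nti => /eqP uiy; apply/topP => w; rewrite uiy.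
have nle i : dotp n (ps i) <= dotp n (ps y).
  by have [-> //|/nlt/ltW] := eqVneq (ps i) (ps y).
have neq i : dotp n (ps i) = dotp n (ps y) -> ps i = ps y.
  by move=> e1; apply/eqP; apply: contraT => /nlt; rewrite e1 ltxx.
have expo z : carrier P z -> dotp n z = dotp n (ps y) -> z = ps y.
  by rewrite Ps => Pz; exact: (hull_exposed (s := s)) Pz.
have Py : carrier P (ps y) by rewrite Ps; exact: mem_hull.
have [v vy] : exists v : vertex P, val v = ps y.
  apply: vertex_val; exists n, (dotp n (ps y)); split; first split.
  - apply/negP => /eqP n0; apply: (@not_singleton (ps y)) => z Pz.
    by apply: expo => //; rewrite n0 !dotp0l.
  - by move=> z; rewrite Ps; exact: hull_le.
  - by exists (ps y).
  apply/seteqP; split=> [_ -> /=|z [Pz /=]]; first by split.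
  exact: expo.
exists v => z; rewrite vy Ps; apply: hull_le => i.
by move/topP: ty; apply.
Qed.

Lemma topE u v : top pos u v <-> forall z, carrier P z -> dotp u z <= dotp u (val v).
Proof.
split=> [/topP tv z Pz|h]; last by apply/topP => w; apply: h; exact: carrier_vertex.
by have [w hw] := max_at_vertex u; apply: le_trans (tv w); exact: hw.
Qed.

Lemma top_flat u v : u != 0 -> top pos u v -> top pos (- u) v -> False.
Proof.
move=> u0 /topE h1 /topE h2; apply: (@full_dim _ P u (dotp u (val v)) u0) => z Pz.
apply: le_anti; rewrite h1 //=.
by have := h2 z Pz; rewrite !dotpNl lerN2.
Qed.

Lemma antipodal_top (v w : vertex P) : antipodal P (val v) (val w) <->
  exists u, [/\ u != 0, top pos u v & top pos (- u) w].
Proof.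
split=> [[_ _ [u u0 h]]|[u [u0 /topE uv /topE uw]]].
  exists u; split=> //; apply/topE => z /h /andP[] //.
  by rewrite !dotpNl lerN2.
split; [exact: carrier_vertex | exact: carrier_vertex |].
exists u => // z Pz; rewrite uv // andbT.
by have := uw z Pz; rewrite !dotpNl lerN2.
Qed.

Lemma antipodal_verticesP (v w : vertex P) : reflect
  (exists u, [/\ u != 0, top pos u v & top pos (- u) w]) (antipodal_vertices v w).
Proof.
apply: (iffP andP) => [[_ /asboolP/antipodal_top//]|h].
split; last by apply/asboolP/antipodal_top.
by have [u [u0 uv uw]] := h; apply/eqP => vw; apply: (top_flat u0 uv); rewrite vw.
Qed.

Lemma vertex_exposed (v : vertex P) : exists u, [/\ u != 0, top pos u v &
  forall x, carrier P x -> dotp u x = dotp u (val v) -> x = val v].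
Proof.
have [u [k [[u0 le_k _] vE]]] := vertexP v.
have uv : dotp u (val v) = k by have /seteqP[/(_ _ erefl)[]] := vE.
exists u; split=> // [|x Px ux]; first by apply/topE => z /le_k; rewrite uv.
by have /seteqP[_ /(_ x)] := vE; apply; split; rewrite //= -uv.
Qed.

End PolyhedronVertices.

(** * Edges inside the faces of a polyhedron *)

Section Faces.
Variables (R : realType) (P : polyhedron R).
Local Notation E3 := 'rV[R]_3.
Local Notation vtop := (top (fun v : vertex P => val v : E3)).
Implicit Types (u d n g z : E3) (v w x y : vertex P).

(** The matrix with rows [a], [b], [c] has a diagonal Gram matrix with nonzero entries, hence is
    invertible. *)
Lemma orthogonal_frame (a b c r : E3) : a != 0 -> b != 0 -> c != 0 ->
  dotp a b = 0 -> dotp a c = 0 -> dotp b c = 0 ->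
  dotp r a = 0 -> dotp r b = 0 -> dotp r c = 0 -> r = 0.
Proof.
move=> a0 b0 c0 ab ac bc ra rb rc.
pose f (i : 'I_3) := nth 0 [:: a; b; c] i; pose M := \matrix_(i < 3) f i.
have MMt i j : (M *m M^T) i j = dotp (f i) (f j).
  by rewrite mxE; apply: eq_bigr => k _; rewrite !mxE.
have uM : M \in unitmx.
  have : M *m M^T = diag_mx (\row_i dotp (f i) (f i)).
    apply/matrixP => i j; rewrite MMt !mxE.
    case: i => -[|[|[|//]]] ?; case: j => -[|[|[|//]]] ?; rewrite /= ?mulr1n ?mulr0n //= /f /=;
    by rewrite // dotpC.
  move=> /(congr1 determinant); rewrite det_mulmx det_tr det_diag => detM.
  rewrite unitmxE unitfE -sqrf_eq0 expr2 detM.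
  apply/prodf_neq0 => i _; rewrite mxE dotpp_eq0.
  by case: i => -[|[|[|//]]] ? /=.
have : r *m M^T = 0.
  apply/rowP => i; rewrite !mxE (eq_bigr (fun k => r 0 k * f i 0 k)); last first.
    by move=> k _; rewrite !mxE.
  by case: i => -[|[|[|//]]] ? /=.
move/(congr1 (mulmx^~ (invmx M^T))); rewrite mul0mx mulmxK // unitmx_tr //.
Qed.

Lemma carrier_convex (x y : E3) t : carrier P x -> carrier P y -> 0 <= t <= 1 ->
  carrier P ((1 - t) *: x + t *: y).
Proof.
have [s ->] := carrier_hull P => -[a [a0 a1 ->]] [b [b0 b1 ->]] /andP[t0 t1].
exists (fun i => (1 - t) * a i + t * b i); split=> [i||].
- by rewrite addr_ge0 // mulr_ge0 // subr_ge0.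
- by rewrite big_split /= -!mulr_sumr a1 b1 !mulr1 subrK.
- rewrite !scaler_sumr -big_split; apply: eq_bigr => i _ /=.
  by rewrite !scalerA scalerDl.
Qed.

(** A vertex maximising [n + e *: g] with [e] small still maximises [n]; when it is compared with
    [z], the contributions of [n] cancel. *)
Lemma face_bound n g v k : vtop n v -> (forall x, vtop n x -> dotp g (val x) <= k) ->
  forall z, carrier P z -> dotp n z = dotp n (val v) -> dotp g z <= k.
Proof.
move=> nv gk z Pz nz; have [e e0 he] := perturbation (fun v : vertex P => val v) n g.
have [y hy] := max_at_vertex P (n + e *: g).
have ny : vtop n y.
  apply/topP => x; rewrite leNgt; apply/negP => /he.
  by rewrite ltNge hy //; exact: carrier_vertex.
apply: le_trans (gk y ny); have := hy z Pz.
by rewrite !dotpDl !dotpZl nz (top_eq nv ny) lerD2l ler_pM2l.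
Qed.

(** Here [v] sits between [z] and [w], so the form exposing [v] is maximal at [w] too. *)
Lemma exposed_extends v w z (t : R) : carrier P z -> t < 0 ->
  z = val v + t *: (val w - val v) -> v = w.
Proof.
move=> Pz t0 ze; have [m [m0 /topE mv mexp]] := vertex_exposed v.
apply/val_inj/esym/mexp; first exact: carrier_vertex.
apply: le_anti; rewrite (mv _ (carrier_vertex w)) /=.
have := mv z Pz; rewrite ze dotpDr dotpZr dotpBr. nra.
Qed.

(** For small [e], [u + e *: d] exposes the part of the face of [u] where [d] is maximal. Both forms
    are constant there, so it lies on a line, with [v] and [w] as ends. *)
Lemma edge_of_face u d v w : u != 0 -> d != 0 -> dotp u d = 0 -> v != w ->
  vtop u v -> vtop u w ->
  (forall x, vtop u x -> dotp d (val x) <= dotp d (val v)) ->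
  (forall x, vtop u x -> dotp d (val x) <= dotp d (val w)) -> is_edge v w.
Proof.
move=> u0 d0 ud vw uv uw dv dw; apply/andP; split => //; apply/asboolP.
have dvw : dotp d (val v) = dotp d (val w) by apply: le_anti; rewrite dv ?dw.
have [e e0 he] := perturbation (fun v : vertex P => val v) u d.
pose n := u + e *: d.
have topn x : vtop n x <-> vtop u x /\ dotp d (val x) = dotp d (val v).
  have nle y : dotp n (val y) <= dotp n (val v).
    have [uy|nuy] := boolP (vtop u y).
      by rewrite !dotpDl !dotpZl (top_eq uy uv) lerD2l ler_pM2l // dv.
    apply/ltW/he; rewrite lt_neqAle (topP _ _ _ uv) andbT.
    by apply: contra nuy => /eqP uy; apply/topP => y'; rewrite uy (topP _ _ _ uv).
  have nv : vtop n v by apply/topP.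
  split=> [nx|[ux dx]]; last first.
    by apply/topP => y; rewrite (le_trans (nle y)) // !dotpDl !dotpZl dx (top_eq ux uv).
  have ux : vtop u x.
    apply: contraT => nux; have : dotp n (val x) < dotp n (val v).
      apply: he; rewrite lt_neqAle (topP _ _ _ uv) andbT.
      by apply: contra nux => /eqP uy; apply/topP => y'; rewrite uy (topP _ _ _ uv).
    by rewrite (top_eq nx nv) ltxx.
  split=> //; have := top_eq nx nv; rewrite !dotpDl !dotpZl (top_eq ux uv) => /addrI.
  by apply: mulfI; rewrite gt_eqF.
have nv : vtop n v by apply/topn.
have nw : vtop n w by apply/topn.
exists n, (dotp n (val v)); split.
  split; first last.
  - by exists (val v) => //; exact: carrier_vertex.
  - by move/topE: nv.
  apply/eqP => /(congr1 (dotp d)); rewrite dotpDr dotpZr dotp0r dotpC ud add0r => /eqP.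
  by rewrite mulf_eq0 dotpp_eq0 (negbTE d0) gt_eqF.
apply/seteqP; split=> [_ [t t01 ->]|z [Pz /= nz]].
  split; first by apply: carrier_convex t01; exact: carrier_vertex.
  by rewrite /= dotpDr !dotpZr (top_eq nw nv) -mulrDl subrK mul1r.
have bound g : (forall x, vtop n x -> dotp g (val x) <= dotp g (val v)) ->
  dotp g z <= dotp g (val v) by move=> hg; apply: (face_bound nv hg Pz nz).
have flat g : (forall x, vtop n x -> dotp g (val x) = dotp g (val v)) -> dotp g z = dotp g (val v).
  move=> hg; apply: le_anti; rewrite bound => [|x /hg ->] //=.
  by rewrite -lerN2 -!dotpNl bound // => x /hg; rewrite !dotpNl => ->.
have uz : dotp u z = dotp u (val v) by apply: flat => x /topn[ux _]; exact: top_eq ux uv.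
have dz : dotp d z = dotp d (val v) by apply: flat => x /topn[].
pose l := val w - val v; have l0 : l != 0 by rewrite subr_eq0 eq_sym.
(* Orthogonal projection of [z] onto the line through [v] and [w]; the residue is orthogonal to [u],
   [d] and [l], hence zero. *)
pose t := dotp (z - val v) l / dotp l l.
have zt : z = val v + t *: l.
  apply/eqP; rewrite -subr_eq0 opprD addrA; apply/eqP.
  have ul : dotp u l = 0 by rewrite dotpBr (top_eq uv uw) subrr.
  have dl : dotp d l = 0 by rewrite dotpBr dvw subrr.
  apply: (orthogonal_frame u0 d0 l0) => //; rewrite dotpBl dotpZl.
  - by rewrite (dotpC l) ul mulr0 subr0 dotpC dotpBr uz subrr.
  - by rewrite (dotpC l) dl mulr0 subr0 dotpC dotpBr dz subrr.
  - by rewrite /t divfK ?subrr // dotpp_eq0.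
exists t; last by rewrite zt /l scalerBl scale1r scalerBr addrA addrAC.
(* For [t] outside [0, 1], [v] or [w] would lie strictly between [z] and the other one. *)
apply/andP; split; rewrite leNgt; apply/negP => tlt.
  by move: vw; rewrite (exposed_extends Pz tlt zt) eqxx.
have t1 : 1 - t < 0 by rewrite subr_lt0.
have : z = val w + (1 - t) *: (val v - val w).
  have e1 : val v = val w + (val v - val w) by rewrite addrC subrK.
  rewrite zt {1}e1 -addrA scalerBl scale1r; congr (_ + (_ + _)).
  by rewrite -scalerN opprB.
by move/(exposed_extends Pz t1) => wv; move: vw; rewrite wv eqxx.
Qed.

(** Distinct vertices of the face that are maximal in it for one direction orthogonal to [u] span an
    edge, and these directions form a connected punctured plane. *)
Theorem face_edge_connected (T : Type) u (p : vertex P -> T) : u != 0 ->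
  (forall v w, vtop u v -> vtop u w -> is_edge v w -> p v = p w) ->
  forall v w, vtop u v -> vtop u w -> p v = p w.
Proof.
move=> u0 pE.
pose W : finType := {v : vertex P | vtop u v}.
pose pos (x : W) : E3 := val (val x).
have pS : punctured_cone (on_plane (@nonzero R) u) by exact/punctured_on_plane/punctured_nonzero.
have ag : agrees pos (on_plane (@nonzero R) u) (p \o val).
  move=> d [v uv] [w uw] [d0 ud] /topP /= dv /topP /= dw.
  have [-> //|vw] := eqVneq v w; apply: pE => //.
  apply: (edge_of_face u0 d0 ud) => // x ux; first exact: (dv (Sub x ux)).
  exact: (dw (Sub x ux)).
have cst : constant_over pos (on_plane (@nonzero R) u) (p \o val).
  apply: punctured_cone_constant pS _ ag => d [d0 ud].
  have [x x0 [xd xu]] := exists_orthogonal d u.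
  by exists x; [split; rewrite // dotpC | rewrite dotpC].
have dir v (uv : vtop u v) : (forall w, vtop u w -> w = v) \/
    exists2 d, on_plane (@nonzero R) u d & top pos d (Sub v uv).
  have [n [n0 nv nexp]] := vertex_exposed v.
  (* The projection of [n] orthogonal to [u], scaled to avoid a division. If it vanishes, [n] is
     constant on the face, which then has [v] as its only vertex. *)
  pose d := dotp u u *: n - dotp u n *: u.
  have ux x : vtop u x -> dotp d (val x) = dotp u u * dotp n (val x) - dotp u n * dotp u (val v).
    by move=> ux; rewrite dotpBl !dotpZl (top_eq ux uv).
  have [d0|d0] := eqVneq d 0.
    left=> w uw; apply/val_inj/nexp; first exact: carrier_vertex.
    apply: (mulfI (x := dotp u u)); first by rewrite dotpp_eq0.
    by have := ux w uw; have := ux v uv; rewrite d0 !dotp0l; lra.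
  right; exists d; first by split=> //; rewrite dotpBr !dotpZr mulrC subrr.
  apply/topP => -[x uxt]; rewrite /pos /= !ux // lerD2r ler_wpM2l ?dotpp_ge0 //.
  by move/topP: nv; apply.
move=> v w uv uw; case: (dir v uv) => [h|[d Sd dv]]; first by rewrite (h w uw).
case: (dir w uw) => [h|[e Se ew]]; first by rewrite (h v uv).
exact: (cst d e (Sub v uv) (Sub w uw)).
Qed.

End Faces.

(** * Integer matrices and quotients *)

Section IntegerMatrices.

Local Notation Q := (map_mx (intr : int -> rat)).

Lemma clear_denominators n (x : 'rV[rat]_n) : exists (a : int) (y : 'rV[int]_n),
  a != 0 /\ a%:~R *: x = Q y.
Proof.
exists (\prod_i denq (x 0 i)).
exists (\row_i (numq (x 0 i) * \prod_(j | j != i) denq (x 0 j))); split.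
  by apply/prodf_neq0 => i _; exact: denq_neq0.
apply/rowP => i; rewrite !mxE (bigD1 i) //= !rmorphM /= mulrAC; congr (_ * _).
by rewrite -{2}(divq_num_den (x 0 i)) mulrC divfK // intr_eq0 denq_neq0.
Qed.

Lemma Q_inj m n : injective (Q : 'M[int]_(m, n) -> 'M[rat]_(m, n)).
Proof.
by move=> A B /matrixP AB; apply/matrixP => i j; have := AB i j; rewrite !mxE => /intr_inj.
Qed.

Lemma exact_mxrank m n p (M : 'M[int]_(m, n)) (N : 'M[int]_(n, p)) (k : int) : k != 0 ->
  M *m N = 0 -> (forall z : 'rV_n, z *m N = 0 -> exists y : 'rV_m, k *: z = y *m M) ->
  \rank (Q M) = (n - \rank (Q N))%N.
Proof.
move=> k0 MN ex; rewrite -mxrank_ker; apply/eqP; rewrite eqn_leq; apply/andP; split.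
  by apply/mxrankS/sub_kermxP; rewrite -map_mxM MN map_mx0.
apply/mxrankS/row_subP => i; set x := row i _.
have xN : x *m Q N = 0 by rewrite -row_mul mulmx_ker row0.
have [a [z [a0 xz]]] := clear_denominators x.
have [|y yM] := ex z.
  by apply: Q_inj; rewrite map_mxM -xz -scalemxAl xN scaler0 map_mx0.
have -> : x = ((k * a)%:~R^-1 *: Q y) *m Q M.
  rewrite -scalemxAl -map_mxM -yM map_mxZ -xz !scalerA rmorphM -mulrA mulVf ?scale1r //.
  by rewrite mulf_neq0 // intr_eq0.
exact: submxMl.
Qed.

(* A direct complement decomposition of the kernel of an integer matrix, read
   off its Smith normal form. *)
Lemma int_kernel m n (M : 'M[int]_(m, n)) : exists (k : nat) (A : 'M[int]_(m, k)) (B : 'M[int]_(k, m)),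
  [/\ B *m A = 1%:M, B *m M = 0 & forall x : 'rV_m, x *m M = 0 -> x *m A *m B = x].
Proof.
have [L uL [R uR [d _ ->]]] := int_Smith_normal_form M.
(* [J] indexes the zero rows of the Smith form and [E] selects these coordinates; transported by
   [L], they give the kernel. *)
set D := \matrix_(i, j) _; pose J := [set i : 'I_m | row i D == 0].
pose E : 'M[int]_(#|J|, m) := \matrix_(i, j) (enum_val i == j)%:R.
have ET (y : 'rV_m) : (forall i, i \notin J -> y 0 i = 0) -> y *m E^T *m E = y.
  move=> y0; apply/rowP => j; rewrite mxE.
  have [jJ|jJ] := boolP (j \in J).
    rewrite (bigD1 (enum_rank_in jJ j)) //= big1 => [|i ij]; last first.
      rewrite [E _ _]mxE; case: eqP => [ej|_]; last by rewrite mulr0.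
      by case/eqP: ij; apply: enum_val_inj; rewrite enum_rankK_in.
    rewrite [E _ _]mxE enum_rankK_in // eqxx mulr1 addr0 mxE (bigD1 j) //= big1.
      by rewrite !mxE enum_rankK_in // eqxx mulr1 addr0.
    by move=> i ij; rewrite !mxE enum_rankK_in // eq_sym (negbTE ij) mulr0.
  rewrite y0 // big1 // => i _; rewrite [E _ _]mxE; case: eqP => [ej|_]; last by rewrite mulr0.
  by move: jJ; rewrite -ej enum_valP.
exists #|J|, (L *m E^T), (E *m invmx L); split.
- rewrite mulmxA mulmxKV //; apply/matrixP => i j; rewrite !mxE (bigD1 (enum_val i)) //=.
  rewrite !mxE eqxx mul1r (inj_eq enum_val_inj) eq_sym big1 ?addr0 // => l li.
  by rewrite !mxE eq_sym (negbTE li) mul0r.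
- rewrite !mulmxA mulmxKV // (_ : E *m D = 0) ?mul0mx //; apply/row_matrixP => i.
  rewrite row0; have := enum_valP i; rewrite inE => /eqP <-.
  rewrite row_mul; apply/rowP => j; rewrite [LHS]mxE (bigD1 (enum_val i)) //= big1.
    by rewrite !mxE eqxx mul1r addr0.
  by move=> l li; rewrite !mxE eq_sym (negbTE li) mul0r.
- move=> x; rewrite !mulmxA => /(congr1 (mulmx^~ (invmx R))); rewrite mulmxK // mul0mx => xD.
  rewrite ET ?mulmxK // => i; rewrite inE => Di.
  have [j Dij] : exists j, D i j != 0.
    apply/existsP; apply: contraR Di; rewrite negb_exists => /forallP Dz.
    by apply/eqP/rowP => j; rewrite mxE [RHS]mxE; apply/eqP; move: (Dz j); rewrite negbK.
  have ij : i = j :> nat.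
    by apply/eqP; apply: contraNT Dij => /negbTE ij; rewrite mxE ij mulr0n.
  have /rowP/(_ j) := xD; rewrite mxE (bigD1 i) //= big1 => [|l li]; last first.
    rewrite [D _ _]mxE -ij; case: eqVneq => [/val_inj e|_]; last by rewrite mulr0n mulr0.
    by move: li; rewrite e eqxx.
  by rewrite addr0 [RHS]mxE => /eqP; rewrite mulf_eq0 (negbTE Dij) orbF => /eqP.
Qed.

Lemma int_kernel_rank m n (M : 'M[int]_(m, n)) k (A : 'M[int]_(m, k)) (B : 'M[int]_(k, m)) :
  B *m A = 1%:M -> B *m M = 0 -> (forall x : 'rV_m, x *m M = 0 -> x *m A *m B = x) ->
  k = (m - \rank (Q M))%N.
Proof.
move=> BA BM ker; rewrite -(exact_mxrank (oner_neq0 _) BM).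
  apply/esym/eqP/row_freeP; exists (Q A).
  by rewrite -map_mxM BA map_mx1.
by move=> z /ker zAB; exists (z *m A); rewrite zAB scale1r.
Qed.

End IntegerMatrices.

(** The first isomorphism theorem, with the induced map computed on representatives. *)
Lemma quot_isomorphic (G B : zmodType) (I : zmodClosed G) (f : {additive G -> B}) :
  (forall x, (x \in I) = (f x == 0)) -> (forall y, exists x, f x = y) ->
  isomorphic (Quotient.quot I) B.
Proof.
move=> ker surj; pose g (h : Quotient.quot I) := f (repr h).
have gpi x : g (\pi_(Quotient.quot I) x) = f x.
  by apply/eqP; rewrite -subr_eq0 -raddfB -ker Quotient.idealrBE reprK eqxx.
have gB : zmod_morphism g.
  by move=> h1 h2; rewrite -[h1]reprK -[h2]reprK -raddfB !gpi raddfB.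
pose gm := GRing.isZmodMorphism.Build _ _ g gB.
pose ga : {additive _ -> _} := HB.pack g gm.
exists ga; have [s sK] := choice surj.
exists (fun y => \pi_(Quotient.quot I) (s y)) => [h|y]; last by rewrite /= gpi sK.
rewrite -[RHS]reprK; apply/eqP; rewrite -Quotient.idealrBE ker raddfB sK.
by rewrite subrr.
Qed.

(** * Homology of a square complex *)

Section SquareComplexHomology.
Variable X : square_complex.
Local Notation V := (sq_vertex X).
Local Notation adj := (@sq_adj X).

Definition vertex_chain (a : V) : chain X 0 := [ffun v => (v == a)%:Z].

Definition edge_chain (a b : V) : chain X 1 := [ffun e => path_step a b e].

(** In degree 0 this is the augmentation; in degree 1 only its parity is independent of the
    orientation of the edges. *)
Definition weight i (c : chain X i) : int := \sum_x c x.

Lemma weightB i : zmod_morphism (@weight i).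
Proof. by move=> c d; rewrite /weight -sumrB; apply: eq_bigr => x _; rewrite !ffunE. Qed.
HB.instance Definition _ i := GRing.isZmodMorphism.Build _ _ (@weight i) (@weightB i).

HB.instance Definition _ i :=
  GRing.isZmodMorphism.Build _ _ (@boundary X i) (@boundaryB X i).

Lemma edge_chainC a b : edge_chain b a = - edge_chain a b.
Proof. by apply/ffunP => e; rewrite !ffunE opprB. Qed.

Lemma cell1_adj (e : cell X 1) : adj (val e).1 (val e).2.
Proof. by have /andP[] := valP e. Qed.

Lemma edge_chain_cell (e : cell X 1) x :
  edge_chain (val e).1 (val e).2 x = (x == e)%:Z.
Proof.
rewrite ffunE /path_step -surjective_pairing (inj_eq val_inj).
have -> : (val x == ((val e).2, (val e).1)) = false; last by rewrite subr0.
apply/negP => /eqP xe.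
have /andP[lte _] := valP e; have /andP[ltx _] := valP x.
by move: ltx; rewrite xe /= ltnNge ltnW.
Qed.

Lemma adj_cell a b : adj a b ->
  exists e : cell X 1, edge_chain a b = edge_chain (val e).1 (val e).2 \/
                       edge_chain a b = - edge_chain (val e).1 (val e).2.
Proof.
move=> ab; case: (ltngtP (enum_rank a) (enum_rank b)) => [lt|gt|/ord_inj/enum_rank_inj eqab].
- have h : (enum_rank (a, b).1 < enum_rank (a, b).2)%N && adj (a, b).1 (a, b).2 by rewrite lt.
  by exists (Sub (a, b) h); left.
- have h : (enum_rank (b, a).1 < enum_rank (b, a).2)%N && adj (b, a).1 (b, a).2.
    by rewrite gt /= sq_adj_sym.
  by exists (Sub (b, a) h); right; rewrite -edge_chainC.
- by move: ab; rewrite eqab sq_adj_irr.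
Qed.

Lemma boundary_edge_chain a b : adj a b ->
  boundary (edge_chain a b) = vertex_chain b - vertex_chain a.
Proof.
move=> ab.
have cellE (e : cell X 1) : boundary (edge_chain (val e).1 (val e).2) =
    vertex_chain (val e).2 - vertex_chain (val e).1.
  apply/ffunP => v; rewrite !ffunE (bigD1 e) //= edge_chain_cell eqxx mul1r big1 ?addr0 //.
  by move=> x /negbTE xe; rewrite edge_chain_cell xe mul0r.
case: (ltngtP (enum_rank a) (enum_rank b)) => [lt|gt|/ord_inj/enum_rank_inj eqab].
- have h : (enum_rank (a, b).1 < enum_rank (a, b).2)%N && adj (a, b).1 (a, b).2 by rewrite lt.
  exact: (cellE (Sub (a, b) h)).
- have h : (enum_rank (b, a).1 < enum_rank (b, a).2)%N && adj (b, a).1 (b, a).2.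
    by rewrite gt /= sq_adj_sym.
  have ba : boundary (edge_chain b a) = vertex_chain a - vertex_chain b.
    exact: (cellE (Sub (b, a) h)).
  by rewrite edge_chainC -opprB -ba; exact: raddfN.
- by move: ab; rewrite eqab sq_adj_irr.
Qed.

Lemma weight_edge_chain a b : adj a b -> (weight (edge_chain a b))%:~R = 1 :> 'Z_2.
Proof.
move=> /adj_cell[e].
have w1 : weight (edge_chain (val e).1 (val e).2) = 1.
  rewrite /weight (bigD1 e) //= edge_chain_cell eqxx big1 ?addr0 //.
  by move=> x /negbTE xe; rewrite edge_chain_cell xe.
by case=> ->; rewrite ?raddfN /= w1 //; apply/val_inj.
Qed.

Lemma vertex_chain_sum (z : chain X 0) : z = \sum_v vertex_chain v *~ z v.
Proof.
apply/ffunP => x; rewrite sum_ffunE (bigD1 x) //= big1 ?addr0.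
  by rewrite ffunMzE ffunE eqxx intz.
by move=> v /negbTE vx; rewrite ffunMzE ffunE eq_sym vx mul0rz.
Qed.

(** Taken inside all 1-chains, not only cycles, so that single edges have classes in the
    quotient. *)
Definition is_bounding : {pred chain X 1} := fun z => `[< exists c, z = boundary c >].

Fact is_bounding_zmod : zmod_closed is_bounding.
Proof.
split=> [|y z]; first by apply/asboolP; exists 0; rewrite raddf0.
move=> /asboolP[c ->] /asboolP[d ->]; apply/asboolP; exists (c - d).
by rewrite raddfB.
Qed.
HB.instance Definition _ := GRing.isZmodClosed.Build (chain X 1) is_bounding is_bounding_zmod.

Definition face_chain (q : sq_face X) : chain X 2 := [ffun x => (x == q)%:Z].

Lemma boundary_face_chain q : boundary (face_chain q) =
  \sum_(k < 4) edge_chain (tnth (sq_attach q) k) (tnth (sq_attach q) (ordS k)).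
Proof.
apply/ffunP => e; rewrite ffunE sum_ffunE (bigD1 q) //= [X in _ + X]big1 => [|x /negbTE xq].
  by rewrite ffunE eqxx mul1r addr0; apply: eq_bigr => k _; rewrite ffunE.
by rewrite ffunE xq mul0r.
Qed.

Lemma attach_adj (q : sq_face X) (k : 'I_4) :
  adj (tnth (sq_attach q) k) (tnth (sq_attach q) (ordS k)).
Proof.
have /andP[cyc _] := sq_attach_cycle q; move: cyc.
case: (sq_attach q) => -[|x1 [|x2 [|x3 [|x4 [|]]]]] //= sz /and5P[a1 a2 a3 a4 _].
by case: k => -[|[|[|[|//]]]] lt4; rewrite !(tnth_nth x1).
Qed.

Lemma weight_boundary (c : chain X 2) : (weight (boundary c))%:~R = 0 :> 'Z_2.
Proof.
have cE : c = \sum_q face_chain q *~ c q.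
  apply/ffunP => x; rewrite sum_ffunE (bigD1 x) //= big1 ?addr0.
    by rewrite ffunMzE ffunE eqxx intz.
  by move=> v /negbTE vx; rewrite ffunMzE ffunE eq_sym vx mul0rz.
rewrite cE (raddf_sum (@boundary X 1)) (raddf_sum (@weight 1)) raddf_sum big1 // => q _.
rewrite (raddfMz (@boundary X 1)) (raddfMz (@weight 1)) raddfMz /= boundary_face_chain.
rewrite (raddf_sum (@weight 1)) raddf_sum (eq_bigr (fun=> 1)) => [|k _]; last first.
  exact/weight_edge_chain/attach_adj.
by rewrite sumr_const card_ord [1 *+ 4](_ : _ = 0) ?mul0rz //; apply/val_inj.
Qed.

Variable v0 : V.
(** [p] and [q] are the restrictions of one function to the two sheets of the bipartite double
    cover. *)
Hypothesis double_cover_connected : forall (T : Type) (p q : V -> T),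
  (forall v w, adj v w -> p v = q w) -> forall v w, p v = p w /\ p v = q w.
(** An antisymmetric cochain vanishing around every square becomes a coboundary on the double
    cover. *)
Hypothesis double_cover_splits : forall (A : zmodType) (c : V -> V -> A),
  (forall v w, c w v = - c v w) ->
  (forall q, \sum_(k < 4) c (tnth (sq_attach q) k) (tnth (sq_attach q) (ordS k)) = 0) ->
  exists a b : V -> A, forall v w, adj v w -> c v w = a v - b w.

(** Reachability by even and by odd weight are the functions put on the two sheets: an edge
    exchanges them, so both spread from the zero chain at [v0]. *)
Lemma parity_walk v (s : 'Z_2) : exists c : chain X 1,
  boundary c = vertex_chain v - vertex_chain v0 /\ (weight c)%:~R = s.
Proof.
pose walk (s : 'Z_2) v := exists c : chain X 1,
  boundary c = vertex_chain v - vertex_chain v0 /\ (weight c)%:~R = s.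
have step t x y : adj x y -> walk t x -> walk (t + 1) y.
  move=> xy [c [bc wc]]; exists (c + edge_chain x y).
  rewrite !raddfD /= bc wc boundary_edge_chain // weight_edge_chain //.
  by rewrite addrC addrA subrK.
have z2 : 1 + 1 = 0 :> 'Z_2 by apply/val_inj.
have same x y : adj x y -> walk 0 x = walk 1 y.
  move=> xy; apply/propext; split=> [/(step _ _ _ xy)|]; first by rewrite add0r.
  by move/(step 1 y x); rewrite z2; apply; rewrite sq_adj_sym.
have w0 : walk 0 v0 by exists 0; rewrite !raddf0 subrr.
have [h1 h2] := double_cover_connected same v0 v.
suff : walk s v by [].
case: s => -[|[|//]] ls; [rewrite (_ : Ordinal ls = 0) -?h1 //|rewrite (_ : Ordinal ls = 1) -?h2 //];
  exact/val_inj.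
Qed.

Lemma boundary_weight0 (z : chain X 0) : weight z = 0 -> exists c : chain X 1, z = boundary c.
Proof.
move=> z0; have [c hc] := choice (fun v => parity_walk v 0).
exists (\sum_v c v *~ z v); rewrite raddf_sum [LHS]vertex_chain_sum.
under [RHS]eq_bigr => v _ do rewrite raddfMz /= (hc v).1 mulrzBl.
by rewrite sumrB -mulrz_sumr -/(weight z) z0 mulr0z subr0.
Qed.

Lemma weight_vertex_boundary (c : chain X 1) : weight (boundary c) = 0.
Proof.
rewrite /weight; under eq_bigr do rewrite ffunE; rewrite exchange_big big1 // => e _ /=.
rewrite -mulr_sumr sumrB (bigD1 (val e).2) //= (bigD1 (P := xpredT) (val e).1) //= !eqxx.
rewrite !big1 ?addr0 ?subrr ?mulr0 // => v /negbTE -> //.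
Qed.

(** Antisymmetry makes [a - b] change sign along each edge; connectedness of the double cover then
    makes it a constant equal to its own opposite. *)
Lemma antisymmetric_splits (A : zmodType) (c : V -> V -> A) :
  (forall v w, c w v = - c v w) ->
  (forall q, \sum_(k < 4) c (tnth (sq_attach q) k) (tnth (sq_attach q) (ordS k)) = 0) ->
  exists (a : V -> A) (g : A), g *+ 2 = 0 /\ forall v w, adj v w -> c v w = a v - a w + g.
Proof.
move=> cN c0; have [a [b ab]] := double_cover_splits cN c0; pose g v := a v - b v.
have gN v w : adj v w -> g v = - g w.
  move=> vw; have e : b v - a w = c v w.
    have wv : adj w v by rewrite sq_adj_sym.
    by rewrite -(opprB (a w)) -(ab w v wv) (cN v w) opprK.
  have av : a v = b v - a w + b w by rewrite e ab // subrK.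
  by rewrite /g opprB av addrAC [b v + _]addrC addrK addrC.
have gcst v : g v = g v0 /\ g v = - g v0.
  have [h1 h2] := double_cover_connected gN v v0; split; first exact: h1.
  by rewrite h2.
exists a, (g v0); split; first by rewrite mulr2n {1}(gcst v0).2 addNr.
by move=> v w vw; rewrite ab // -(gcst w).1 /g addrA subrK.
Qed.

Lemma edge_chain_sum (z : chain X 1) : z = \sum_e edge_chain (val e).1 (val e).2 *~ z e.
Proof.
apply/ffunP => x; rewrite sum_ffunE (bigD1 x) //= big1 ?addr0.
  by rewrite ffunMzE edge_chain_cell eqxx intz.
by move=> e /negbTE ex; rewrite ffunMzE edge_chain_cell eq_sym ex mul0rz.
Qed.

(** Summation by parts: the boundary is adjoint to the coboundary. *)
Lemma sum_boundary (A : zmodType) (a : V -> A) (z : chain X 1) :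
  \sum_v a v *~ boundary z v = \sum_e (a (val e).2 - a (val e).1) *~ z e.
Proof.
under eq_bigr do rewrite ffunE mulrz_sumr.
rewrite exchange_big /=; apply: eq_bigr => e _.
have pick x : \sum_v a v *~ (v == x)%:Z = a x.
  by rewrite (bigD1 x) //= eqxx big1 ?addr0 ?mulr1z // => v /negbTE ->; rewrite mulr0z.
rewrite -(pick (val e).2) -(pick (val e).1) -sumrB mulrz_suml; apply: eq_bigr => v _.
by rewrite -mulrzBr -mulrzA mulrC.
Qed.

Lemma even_multiple (n : int) : n%:~R = 0 :> 'Z_2 -> exists k : int, n = 2 * k.
Proof.
move/eqP; rewrite -(dvdz_pcharf (p := 2)); last by rewrite inE.
by move/dvdzP => [k ->]; exists k; rewrite mulrC.
Qed.

(** Modulo boundaries an edge is a difference of potentials plus [g]. Over a cycle the potentials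
    cancel, and an even number of copies of [g] is zero. *)
Lemma even_cycle_bounds (z : chain X 1) : boundary z = 0 -> (weight z)%:~R = 0 :> 'Z_2 ->
  exists c, z = boundary c.
Proof.
move=> bz /even_multiple[k wk]; set A := Quotient.quot is_bounding.
pose f : {additive chain X 1 -> A} := \pi_A.
have fE y : (f y == 0) = (y \in is_bounding).
  by rewrite -{1}(raddf0 f) -[RHS](congr1 (fun t => t \in is_bounding) (subr0 y)) Quotient.idealrBE.
have cN v w : f (edge_chain w v) = - f (edge_chain v w) by rewrite edge_chainC raddfN.
have [q|a [g [g2 cE]]] := antisymmetric_splits cN.
  rewrite -raddf_sum /= -boundary_face_chain; apply/eqP; rewrite fE.
  by apply/asboolP; exists (face_chain q).
suff : f z == 0 by rewrite fE => /asboolP.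
rewrite (edge_chain_sum z) (raddf_sum f).
under eq_bigr => e _ do rewrite raddfMz cE ?cell1_adj // mulrzDl -opprB mulNrz.
rewrite big_split /= -mulrz_sumr -/(weight z) wk mulrzA mulrz_nat g2 mul0rz addr0.
by rewrite sumrN -sum_boundary bz big1 ?oppr0 // => v _; rewrite ffunE mulr0z.
Qed.

Lemma is_boundaryE i (z : cycle_group X i) :
  z \in is_boundary (i := i) <-> exists c : chain X i.+1, val z = boundary c.
Proof. by split=> [/asboolP|?]; last exact/asboolP. Qed.

Theorem homology0 : isomorphic (homology X 0) int.
Proof.
pose f : {additive cycle_group X 0 -> int} := @weight 0 \o val.
apply: (quot_isomorphic (f := f)) => [z|n].
  apply/idP/eqP => [/is_boundaryE[c zc]|/boundary_weight0 z0]; last exact/is_boundaryE.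
  by rewrite /f /= zc weight_vertex_boundary.
exists (Sub (vertex_chain v0 *~ n) isT).
rewrite /f /= (raddfMz (@weight 0)) /= /weight (bigD1 v0) //= ffunE eqxx big1 ?addr0 ?intz //.
by move=> v /negbTE vv0; rewrite ffunE vv0.
Qed.

Theorem homology1 : isomorphic (homology X 1) 'Z_2.
Proof.
pose f : {additive cycle_group X 1 -> 'Z_2} := intr \o (@weight 1 \o val).
apply: (quot_isomorphic (f := f)) => [z|s].
  apply/idP/eqP => [/is_boundaryE[c zc]|z0]; first by rewrite /f /= zc weight_boundary.
  by apply/is_boundaryE/even_cycle_bounds => //; exact/eqP/(valP z).
have [c [bc wc]] := parity_walk v0 s.
have cyc : c \in @is_cycle X 1 by rewrite unfold_in /= bc subrr.
by exists (Sub c cyc).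
Qed.

Lemma chain_void i : (3 <= i)%N -> forall c : chain X i, c = 0.
Proof. by case: i => [|[|[|i]]] // _ c; apply/ffunP => -[]. Qed.

Theorem homology_ge3 i : (3 <= i)%N -> forall h : homology X i, h = 0.
Proof.
move=> i3 h; rewrite -[h]reprK -[RHS](raddf0 \pi_(homology X i)).
by congr (\pi_(homology X i) _); apply: val_inj; rewrite /= [LHS]chain_void.
Qed.

(** * Boundary maps as integer matrices, and the rank of the second homology *)

Definition chain_row i (c : chain X i) : 'rV[int]_(#|cell X i|) := \row_j c (enum_val j).

Definition row_chain i (r : 'rV[int]_(#|cell X i|)) : chain X i := [ffun x => r 0 (enum_rank x)].

Definition incidence_mx i : 'M[int]_(#|cell X i.+1|, #|cell X i|) :=
  \matrix_(j, k) incidence (enum_val j) (enum_val k).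

Lemma chain_rowK i : cancel (@chain_row i) (@row_chain i).
Proof. by move=> c; apply/ffunP => x; rewrite !ffunE mxE enum_rankK. Qed.

Lemma row_chainK i : cancel (@row_chain i) (@chain_row i).
Proof. by move=> r; apply/rowP => j; rewrite mxE ffunE enum_valK. Qed.

Lemma chain_row_boundary i (c : chain X i.+1) :
  chain_row (boundary c) = chain_row c *m incidence_mx i.
Proof.
apply/rowP => k; rewrite !mxE ffunE [LHS](reindex _ (onW_bij _ (enum_val_bij _))) /=.
by apply: eq_bigr => j _; rewrite !mxE.
Qed.

Lemma chain_rowB i : zmod_morphism (@chain_row i).
Proof. by move=> c d; apply/rowP => j; rewrite !mxE !ffunE. Qed.
HB.instance Definition _ i := GRing.isZmodMorphism.Build _ _ (@chain_row i) (@chain_rowB i).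

Lemma incidence_mxK i : incidence_mx i.+1 *m incidence_mx i = 0.
Proof.
apply/row_matrixP => j; rewrite row0 rowE mulmxA.
by rewrite -[delta_mx _ _]row_chainK -!chain_row_boundary boundaryK raddf0.
Qed.

Theorem homology2 : exists k : nat,
  k%:Z = #|V|%:Z - 1 - #|cell X 1|%:Z + #|sq_face X|%:Z /\
  isomorphic (homology X 2) 'rV[int]_k.
Proof.
have [k [A [B [BA BM ker]]]] := int_kernel (incidence_mx 1).
exists k; split; last first.
  pose f : {additive cycle_group X 2 -> 'rV[int]_k} := mulmxr A \o (@chain_row 2 \o val).
  have cycE (z : cycle_group X 2) : chain_row (val z) *m incidence_mx 1 = 0.
    by have /eqP zc := valP z; rewrite -chain_row_boundary zc raddf0.
  apply: (quot_isomorphic (f := f)) => [z|r].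
    apply/idP/eqP => [/is_boundaryE[c]|fz].
      by rewrite (chain_void _ c) // raddf0 => z0; rewrite /f /= z0 raddf0 mul0mx.
    apply/is_boundaryE; exists 0; rewrite raddf0 -[LHS]chain_rowK -(ker _ (cycE z)).
    by rewrite [_ *m A]fz mul0mx -(raddf0 (@chain_row 2)) chain_rowK.
  have cyc : row_chain (r *m B) \in @is_cycle X 2.
    rewrite unfold_in /=; apply/eqP/(can_inj (@chain_rowK 1)).
    by rewrite chain_row_boundary row_chainK -mulmxA BM mulmx0 raddf0.
  by exists (Cycle cyc); rewrite /f /= row_chainK -mulmxA BA mulmx1.
have kE := int_kernel_rank BA BM ker.
(* The matrix of the augmentation, whose kernel is the image of the first boundary map. *)
pose one : 'M[int]_(#|cell X 0|, 1) := const_mx 1.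
have weightE (c : chain X 0) : chain_row c *m one = const_mx (weight c).
  apply/matrixP => i j; rewrite !mxE /weight [RHS](reindex _ (onW_bij _ (enum_val_bij _))) /=.
  by apply: eq_bigr => l _; rewrite !mxE mulr1.
have V0 : (0 < #|V|)%N by apply/card_gt0P; exists v0.
have r1 : \rank (map_mx (intr : int -> rat) one) = 1%N.
  apply/eqP; rewrite eqn_leq rank_leq_col lt0n mxrank_eq0; apply/eqP => /matrixP one0.
  by have := one0 (Ordinal V0) 0; rewrite !mxE => /eqP; rewrite oner_eq0.
have r0 : \rank (map_mx (intr : int -> rat) (incidence_mx 0)) = (#|V| - 1)%N.
  rewrite (exact_mxrank (oner_neq0 _) (N := one)) ?r1 //.
    apply/row_matrixP => j; rewrite row0 rowE mulmxA -[delta_mx _ _]row_chainK.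
    by rewrite -chain_row_boundary weightE weight_vertex_boundary; apply/matrixP => ? ?; rewrite !mxE.
  move=> z; rewrite -[z]row_chainK weightE => /matrixP/(_ 0 0); rewrite !mxE.
  move=> /boundary_weight0[c ->]; exists (chain_row c).
  by rewrite scale1r chain_row_boundary.
have r2 : \rank (map_mx (intr : int -> rat) (incidence_mx 1)) = (#|cell X 1| - (#|V| - 1))%N.
  (* Twice a cycle has even weight and hence bounds, so exactness at 1-chains holds up to the factor
     2. *)
  rewrite (exact_mxrank (k := 2) _ (incidence_mxK 0)) ?r0 // => z.
  rewrite -[z]row_chainK -chain_row_boundary -(raddf0 (@chain_row 0)).
  move=> /(can_inj (@chain_rowK 0)) bz.
  have [||c hc] := @even_cycle_bounds (row_chain z *+ 2).
  - by rewrite (raddfMn (@boundary X 0)) /= bz mul0rn.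
  - by rewrite (raddfMn (@weight 1)) raddfMn /= -mulr_natr (_ : 2%:R = 0) ?mulr0 //; apply/val_inj.
  exists (chain_row c); rewrite -chain_row_boundary -hc (raddfMn (@chain_row 1)) /=.
  by rewrite -scaler_nat.
(* These bounds keep the natural-number subtractions from truncating. *)
have le1 := rank_leq_row (map_mx (intr : int -> rat) (incidence_mx 1)).
have le0 := rank_leq_row (map_mx (intr : int -> rat) (incidence_mx 0)).
rewrite r0 in le0; rewrite r2 in le1 kE.
rewrite kE -[#|sq_face X|]/(#|cell X 2|); move: V0 le0 le1; lia.
Qed.

End SquareComplexHomology.

(** * The antipodal square complex *)

Section AntipodalComplex.
Variables (R : realType) (P : polyhedron R).
Local Notation E3 := 'rV[R]_3.
Local Notation vtop := (top (fun v : vertex P => val v : E3)).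
Local Notation X := (antipodal_square_complex P).

(** All maximisers of [u] are antipodal to a common maximiser of [- u], so [p] is constant on them;
    connectedness of the nonzero directions does the rest. *)
Lemma antipodal_connected (T : Type) (p q : vertex P -> T) :
  (forall v w, antipodal_vertices v w -> p v = q w) ->
  forall v w, p v = p w /\ p v = q w.
Proof.
move=> pq; pose nz := @nonzero R.
have cst : constant_over (fun v : vertex P => val v : E3) nz p.
  apply: punctured_cone_constant => [|u u0|u v v' u0 uv uv']; first exact: punctured_nonzero.
    by have [d d0 [du _]] := exists_orthogonal u u; exists d => //; rewrite dotpC.
  have [w uw] := exists_top (fun v : vertex P => val v : E3) (- u) v.
  by rewrite (pq v w) ?(pq v' w) //; apply/antipodal_verticesP; exists u.
have pcst v w : p v = p w.
  have [n [n0 nv _]] := vertex_exposed v; have [m [m0 mw _]] := vertex_exposed w.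
  exact: (cst n m).
move=> v w; split; first exact: pcst.
have [n [n0 nw _]] := vertex_exposed w.
have [x nx] := exists_top (fun v : vertex P => val v : E3) (- n) v.
rewrite (pcst v x); apply: pq; apply/antipodal_verticesP; exists (- n).
by rewrite oppr_eq0 opprK.
Qed.

Lemma segmentC (x y : E3) : segment x y = segment y x.
Proof.
by apply/seteqP; split=> z [t /andP[t0 t1] ->]; exists (1 - t);
  rewrite ?subr_ge0 ?t1 ?gerBl ?t0 // subKr addrC.
Qed.

Lemma is_edge_cell (v w : vertex P) : is_edge v w ->
  exists e : edge P, val e = (v, w) \/ val e = (w, v).
Proof.
move=> vw; case: (ltngtP (enum_rank v) (enum_rank w)) => [lt|gt|/ord_inj/enum_rank_inj eqvw].
- have h : (enum_rank (v, w).1 < enum_rank (v, w).2)%N && is_edge (v, w).1 (v, w).2 by rewrite lt.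
  by exists (Sub (v, w) h); left.
- have h : (enum_rank (w, v).1 < enum_rank (w, v).2)%N && is_edge (w, v).1 (w, v).2.
    by rewrite gt /= /is_edge eq_sym segmentC.
  by exists (Sub (w, v) h); right.
- by move: vw; rewrite eqvw /is_edge eqxx.
Qed.

Lemma midpoint_carrier (e : edge P) : carrier P (midpoint e).
Proof.
have -> : midpoint e = (1 - 2^-1) *: val (val e).1 + 2^-1 *: val (val e).2.
  by rewrite /midpoint scalerDr; congr (_ *: _ + _); lra.
by apply: carrier_convex; [exact: carrier_vertex | exact: carrier_vertex |]; apply/andP; split; lra.
Qed.

Lemma midpoint_top u (e : edge P) : vtop u (val e).1 -> vtop u (val e).2 ->
  forall z, carrier P z -> dotp u z <= dotp u (midpoint e).
Proof.
move=> /topE u1 /topE u2 z Pz; rewrite dotpZr dotpDr.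
by have := u1 z Pz; have := u2 z Pz; lra.
Qed.

Lemma antipodal_edges_top u (e f : edge P) : u != 0 ->
  vtop u (val e).1 -> vtop u (val e).2 -> vtop (- u) (val f).1 -> vtop (- u) (val f).2 ->
  antipodal_edges e f.
Proof.
move=> u0 e1 e2 f1 f2; apply/andP; split.
  by apply/eqP => ef; apply: (top_flat u0 e1); rewrite ef.
apply/asboolP; split; [exact: midpoint_carrier | exact: midpoint_carrier |].
exists u => // z Pz; rewrite (midpoint_top e1 e2) // andbT.
by have := midpoint_top f1 f2 Pz; rewrite !dotpNl lerN2.
Qed.

Lemma antipodal_edgesC (e f : edge P) : antipodal_edges e f = antipodal_edges f e.
Proof. by rewrite /antipodal_edges eq_sym; congr (_ && _); apply/asboolP/asboolP => /antipodal_sym. Qed.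

(** * From the squares of the complex to all four-cycles between opposite faces *)

Section Cocycle.
Variables (A : zmodType) (c : vertex P -> vertex P -> A).
Hypothesis cN : forall v w, c w v = - c v w.
Hypothesis cface : forall q : sq_face X,
  \sum_(k < 4) c (tnth (sq_attach q) k) (tnth (sq_attach q) (ordS k)) = 0.

(** This shape says that one function of the third argument agrees at [w] and [w'], as needed for
    propagation along edges of a face. *)
Definition square v v' w w' := c v w - c v' w = c v w' - c v' w'.

Lemma squareCl v v' w w' : square v v' w w' -> square v' v w w'.
Proof. by rewrite /square => h; rewrite -opprB h opprB. Qed.

Lemma squareCr v v' w w' : square v v' w w' -> square v v' w' w.
Proof. by move/esym. Qed.

Lemma square_swap v v' w w' : square v v' w w' -> square w w' v v'.
Proof.
rewrite /square !(cN _ w) !(cN _ w') !opprK => /eqP; rewrite subr_eq => /eqP ->.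
by rewrite !opprD opprK addrAC (addrC (- c v w')) subrK addrC.
Qed.

Lemma square_face (e f : edge P) : (enum_rank e < enum_rank f)%N -> antipodal_edges e f ->
  square (val e).1 (val e).2 (val f).1 (val f).2.
Proof.
move=> lt_ef ef.
have h : (enum_rank (e, f).1 < enum_rank (e, f).2)%N && antipodal_edges (e, f).1 (e, f).2.
  by rewrite lt_ef.
have := cface (Sub (e, f) h); rewrite !big_ord_recl big_ord0 !(tnth_nth (val e).1) /= addr0.
rewrite (cN (val e).2 (val f).1) (cN (val e).1 (val f).2) addrA => /eqP.
by rewrite addr_eq0 opprB => /eqP.
Qed.

Lemma square_edges u v v' w w' : u != 0 -> vtop u v -> vtop u v' ->
  vtop (- u) w -> vtop (- u) w' -> is_edge v v' -> is_edge w w' -> square v v' w w'.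
Proof.
move=> u0 uv uv' uw uw' /is_edge_cell[e ee] /is_edge_cell[f ff].
have [e1 e2] : vtop u (val e).1 /\ vtop u (val e).2 by case: ee => ->.
have [f1 f2] : vtop (- u) (val f).1 /\ vtop (- u) (val f).2 by case: ff => ->.
have ef := antipodal_edges_top u0 e1 e2 f1 f2.
have : square (val e).1 (val e).2 (val f).1 (val f).2.
  case: (ltngtP (enum_rank e) (enum_rank f)) => [lt|gt|/ord_inj/enum_rank_inj eqef].
  - exact: square_face.
  - by apply/square_swap/square_face; rewrite // antipodal_edgesC.
  - by move: ef; rewrite eqef /antipodal_edges eqxx.
by case: ee ff => -> [] -> //= h; try exact: squareCr; try exact: squareCl; exact/squareCl/squareCr.
Qed.

Lemma square_faces u v v' w w' : u != 0 -> vtop u v -> vtop u v' ->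
  vtop (- u) w -> vtop (- u) w' -> square v v' w w'.
Proof.
move=> u0 uv uv' uw uw'; have nu0 : - u != 0 by rewrite oppr_eq0.
(* Edge connectedness is used first in the face of [- u], then in that of [u], leaving a pair of
   edges. *)
apply: (face_edge_connected (p := fun w => c v w - c v' w) nu0) uw uw' => {w w'} w w' uw uw' ww'.
apply/square_swap.
apply: (face_edge_connected (p := fun v => c w v - c w' v) u0) uv uv' => {v v'} v v' uv uv' vv'.
exact/square_swap/(square_edges u0).
Qed.

Lemma antipodal_splits : exists a b : vertex P -> A,
  forall v w, antipodal_vertices v w -> c v w = a v - b w.
Proof.
have [||a [b ab]] := @nonzero_splits _ _ (fun v : vertex P => val v : E3) A c.
- by move=> u v u0; exact: top_flat.
- move=> u v v' w w' u0 uv uv' uw uw'; apply/eqP.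
  rewrite -addrA addr_eq0 opprB; apply/eqP.
  exact: (square_faces u0).
- by exists a, b => v w /antipodal_verticesP[u [u0 uv uw]]; exact: ab uv uw.
Qed.

End Cocycle.

End AntipodalComplex.

Theorem theorem1p2 (R : realType) (P : polyhedron R) :
  let X := antipodal_square_complex P in
  [/\ isomorphic (homology X 0) int,
      isomorphic (homology X 1) 'Z_2,
      0 <= antipodal_defect P /\ isomorphic (homology X 2) 'rV[int]_(`|antipodal_defect P|%N) &
      forall i : nat, (3 <= i)%N -> forall h : homology X i, h = 0].
Proof.
move=> X; have [v0 _] := max_at_vertex P 0.
have conn : forall (T : Type) (p q : sq_vertex X -> T),
  (forall v w, sq_adj v w -> p v = q w) -> forall v w, p v = p w /\ p v = q w.
  exact: antipodal_connected.
have split : forall (A : zmodType) (c : sq_vertex X -> sq_vertex X -> A),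
  (forall v w, c w v = - c v w) ->
  (forall q, \sum_(k < 4) c (tnth (sq_attach q) k) (tnth (sq_attach q) (ordS k)) = 0) ->
  exists a b : sq_vertex X -> A, forall v w, sq_adj v w -> c v w = a v - b w.
  by move=> A c cN c0; exact: antipodal_splits.
split.
- exact: (@homology0 X v0 conn).
- exact: (@homology1 X v0 conn split).
- have [k [kE iso]] := @homology2 X v0 conn split.
  (* The defect is the rank [k], which also yields its nonnegativity. *)
  have -> : antipodal_defect P = k%:Z by rewrite kE.
  by split.
- exact: homology_ge3.
Qed.
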